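(* Let $\lambda$ be a partition with block form $(w_1^{h_1},\dots,w_N^{h_N})$, let $1\le b_1\le N$, and let $X=\{x_1\}$ with $x_1=[b_1](1,w_{b_1})$ (the last box of the lowest row of block $b_1$). Let $\Phi_1:\mathcal F_{\lambda,n}\to V\otimes \mathcal F_{\lambda\setminus X,n}$ be the linear map with $$\Phi_1(T)=\sum_{P}\frac{(-1)^{P}}{H(P)}\,P(T)$$ for every filling $T$, the sum being over all $1$-paths $P$ on $\lambda$ removing $X$. Then $\Phi_1$ is a $GL(V)$-map; that is, $\Phi_1(\mathcal R_{\lambda,n})\subset V\otimes\mathcal R_{\lambda\setminus X,n}$, so that $\Phi_1$ descends to a map $$\Phi_1:\mathbb S_\lambda(V)\to V\otimes \mathbb S_{\lambda\setminus X}(V),$$ and $\Phi_1$ is $GL(V)$-equivariant.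
   Context: $V$ is a complex vector space of dimension $n$ with basis $e_1,\dots,e_n$, and $\lambda$ is a partition of $d$. **Blocks.** Write $\lambda=(w_1^{h_1},\dots,w_N^{h_N})$ with $0<w_1<\dots<w_N$, where exactly $h_b\ge 1$ parts equal $w_b$. Block $[b]$ consists of the $h_b$ rows of length $w_b$ (block $1$ is geometrically lowest, block $N$ is at the top of the diagram); $[b](i)$ is the $i$-th row of block $b$ counted from the bottom; $[b](i,j)$ is the box in column $j$ (from the left) of that row. For boxes, $[b](i,j)\le[c](k,l)$ means $b<c$, or $b=c$ and $i\le k$ (weakly lower row); $<$ means strictly lower row; rows and blocks are compared similarly. **Modules.** $\mathcal F_{\lambda,n}$ is the complex vector space with basis all fillings $T$ of the diagram of $\lambda$ with entries in $\{1,\dots,n\}$ (no further condition); $T_x$ is the entry in box $x$. $GL(V)$ acts on $\mathcal F_{\lambda,n}$ through the identification with $V^{\otimes d}$ sending $T$ to the tensor product of the $e_{T_x}$, boxes read row by row. For a set $A$ of boxes, $w_A$ is the maximal length of a row of $\lambda$ containing a box of $A$, $\mathfrak S_A$ is the group of permutations of the boxes preserving $A$ and fixing all other boxes (acting on fillings), and $G_A=\sum_{\sigma\in \mathfrak S_A}\sigma$. $\mathcal R_{\lambda,n}\subset\mathcal F_{\lambda,n}$ is the subspace spanned by all $T_1-T_2$ with $T_1,T_2$ equal up to permuting entries within rows, and all $G_A(T)$ with $|A|>w_A$. The Schur module is $\mathbb S_\lambda(V)=\mathcal F_{\lambda,n}/\mathcal R_{\lambda,n}$. **Evacuation route** starting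 at $[b_1]$: a set $R$ of boxes of $\lambda$ containing a box of row $[b_1](1)$, containing at most one box per row, and such that if $[b](i,j)\in R$ then $R$ contains a box of row $[b](k)$ for every $1\le k<i$. **$1$-path.** Let $Y=\{y_1\}$, $y_1=[N+1](1,1)$ an extra box attached above the diagram. A $1$-path $P$ removing $X$ is a map $P:\lambda\cup Y\to\lambda\cup Y$ (of boxes) together with an evacuation route $R=R^P$ starting at $[b_1]$ (which may or may not contain $x_1$) such that: - $x\le P(x)$ for all $x$, and $x<P(x)$ for $x\in R$; - if $R_1=\{x_1,P(x_1),P^2(x_1),\dots\}$, then $y_1\in R_1$ and $R\cup X\cup Y=R_1$; - if $[b](i,j),[b](k,l)\in R$ with $i<k$ and both images under $P$ lie in $[b]$, then $P([b](i,j))<P([b](k,l))$; - $P$ is the identity outside $R\cup X$, and $P(R\cup X)=(R\setminus X)\cup Y$. **Coefficients.** $h^P$ is the number of rows meeting $R^P$ and $(-1)^P:=(-1)^{h^P}$. For $b\ge b_1+1$ put $h(b)=w_b-w_{b-1}+h_{b-1}$ and $H(b)=\sum_{j=b_1+1}^{b}h(j)$. Put $H_{b_1}(P)=1$ and, for $b>b_1$, $H_b(P)=1$ if $R^P\cap[b]=\emptyset$ and $H_b(P)=H(b)$ otherwise. $H(P)=\prod_{b=b_1}^N H_b(P)$. **Action on fillings.** $P(T)=e_{\alpha_1^P}\otimes T_P$, where $\alpha_1^P$ is the entry of $T$ in the box of $\lambda$ that $P$ maps to $y_1$, and $T_P$ is the filling of $\lambda\setminus X$ whose entry in a box $c$ is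 the entry of $T$ in the unique box of $\lambda$ that $P$ maps to $c$. *)

(* Defs.v *)
From HB Require Import structures.
From mathcomp Require Import all_boot all_order all_fingroup all_algebra.
From mathcomp Require Import finmap.

Set Implicit Arguments.
Unset Strict Implicit.
Unset Printing Implicit Defensive.

Import GRing.Theory passmx.
Local Open Scope ring_scope.

(* The quotient of [W] by [U] is carried by a chosen complement of [U];
   [qproj_ker] and [qproj_img] say that [qproj U] is a quotient map. *)
Definition quot (K : fieldType) (W : vectType K) (U : {vspace W}) :
  vectType K := subvs_of (U^C)%VS.

Definition qproj (K : fieldType) (W : vectType K) (U : {vspace W}) :
  'Hom(W, quot U) := linfun (vsproj (U^C)%VS \o daddv_pi (U^C)%VS U).

Definition qmap (K : fieldType) (W W' : vectType K) (U : {vspace W})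
    (U' : {vspace W'}) (f : 'Hom(W, W')) : 'Hom(quot U, quot U') :=
  (qproj U' \o f \o linfun (vsval : quot U -> W))%VF.

Lemma qproj_vsval (K : fieldType) (W : vectType K) (U : {vspace W})
  (s : quot U) : qproj U (vsval s) = s.
Proof.
rewrite lfunE /= daddv_pi_id; first by rewrite vsvalK.
  by rewrite capvC capv_compl.
exact: subvsP.
Qed.

Lemma qproj_img (K : fieldType) (W : vectType K) (U : {vspace W}) :
  limg (qproj U) = fullv.
Proof.
apply/eqP; rewrite eqEsubv subvf; apply/subvP => s _.
by rewrite -(qproj_vsval s) memv_img ?memvf.
Qed.

Lemma qproj_ker (K : fieldType) (W : vectType K) (U : {vspace W}) :
  lker (qproj U) = U.
Proof.
have capU : (U^C :&: U = 0)%VS by rewrite capvC capv_compl.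
have decU t : t = daddv_pi (U^C)%VS U t + daddv_pi U (U^C)%VS t.
  by rewrite daddv_pi_add // addvC addv_complf memvf.
apply/vspaceP => t; rewrite memv_ker lfunE /=; apply/eqP/idP => [t0 | tU].
  suff p0 : daddv_pi (U^C)%VS U t = 0 by rewrite (decU t) p0 add0r memv_pi.
  by rewrite -[LHS](@vsprojK _ _ (U^C)%VS) ?memv_pi //= t0 linear0.
suff -> : daddv_pi (U^C)%VS U t = 0 by rewrite linear0.
by rewrite -[LHS](addrK (daddv_pi U (U^C)%VS t)) -decU daddv_pi_id ?capv_compl ?subrr.
Qed.

Lemma qmapE (K : fieldType) (W W' : vectType K) (U : {vspace W})
    (U' : {vspace W'}) (f : 'Hom(W, W')) (t : W) :
  (f @: U <= U')%VS -> qmap U U' f (qproj U t) = qproj U' (f t).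
Proof.
move=> fU; set s := qproj U t.
have stU : vsval s - t \in U.
  have : vsval s - t \in lker (qproj U).
    by rewrite memv_ker linearB /= qproj_vsval subrr.
  by rewrite qproj_ker.
have : f (vsval s - t) \in lker (qproj U').
  by rewrite qproj_ker (subvP fU) // memv_img.
rewrite memv_ker !linearB /= subr_eq0 => /eqP <-.
by rewrite !comp_lfunE; congr (qproj U' (f _)); rewrite lfunE.
Qed.

(* [tens V W] is the tensor product of [V] and [W]: the coordinates of a
   tensor in [vbasis fullv] are arranged in a matrix, and the coordinates of
   [tmul v t] are the products of those of [v] and [t]. *)
Definition tens (K : fieldType) (V W : vectType K) : vectType K :=
  'M[K]_(\dim {:V}, \dim {:W}).

Definition tmul (K : fieldType) (V W : vectType K) (v : V) (t : W) :
  tens V W := (rVof (vbasis {:V}) v)^T *m rVof (vbasis {:W}) t.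

Definition tmap (K : fieldType) (V W V' W' : vectType K) (f : 'Hom(V, V'))
    (g : 'Hom(W, W')) : 'Hom(tens V W, tens V' W') :=
  linfun (fun A : 'M[K]_(\dim {:V}, \dim {:W}) =>
    (mxof (vbasis {:V}) (vbasis {:V'}) f)^T *m A
      *m mxof (vbasis {:W}) (vbasis {:W'}) g : tens V' W').

Definition tensv (K : fieldType) (V W : vectType K) (A : {vspace V})
    (B : {vspace W}) : {vspace tens V W} :=
  <<[seq tmul v t | v <- vbasis A, t <- vbasis B]>>%VS.

Lemma tmap_tmul (K : fieldType) (V W V' W' : vectType K) (f : 'Hom(V, V'))
    (g : 'Hom(W, W')) (v : V) (t : W) :
  tmap f g (tmul v t) = tmul (f v) (g t).
Proof.
pose F (A : 'M[K]_(\dim {:V}, \dim {:W})) : tens V' W' :=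
  (mxof (vbasis {:V}) (vbasis {:V'}) f)^T *m A
    *m mxof (vbasis {:W}) (vbasis {:W'}) g.
have linF : linear F.
  by move=> a A B; rewrite /F mulmxDr mulmxDl -scalemxAr -scalemxAl.
pose FL := GRing.isLinear.Build K _ _ _ F linF.
pose F' : {linear _ -> _} := HB.pack F FL.
have -> : tmap f g = linfun F' by [].
rewrite lfunE /= /F /tmul !mulmxA -trmx_mul.
have vb (U : vectType K) : basis_of {:U} (vbasis {:U}) by exact: vbasisP.
by rewrite -(rVof_app _ (vb V)) -mulmxA -(rVof_app _ (vb W)).
Qed.

(* [(b, i, j)] is the box [b](i,j); its row [(b, i)] is the row [b](i). *)
Notation box := (nat * nat * nat)%type.

Definition brow (c : box) : nat * nat := c.1.
Definition blk (c : box) : nat := c.1.1.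
Definition idx (c : box) : nat := c.1.2.

Definition box_le (x y : box) : bool :=
  (blk x < blk y)%N || (blk x == blk y) && (idx x <= idx y)%N.
Definition box_lt (x y : box) : bool :=
  (blk x < blk y)%N || (blk x == blk y) && (idx x < idx y)%N.

Local Open Scope fset_scope.

(* The diagram of the partition with [h b] parts equal to [w b], for [b] from
   [1] to [N]; the values of [w] and [h] outside this range play no role. *)
Definition diagram (N : nat) (w h : nat -> nat) : {fset box} :=
  [fset x in flatten [seq flatten [seq [seq (b, i, j) | j <- iota 1 (w b)]
                                      | i <- iota 1 (h b)] | b <- iota 1 N]].

Lemma mem_diagram (N : nat) (w h : nat -> nat) (b i j : nat) :
  ((b, i, j) \in diagram N w h)
    = [&& (0 < b <= N)%N, (0 < i <= h b)%N & (0 < j <= w b)%N].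
Proof.
rewrite inE; apply/flatten_mapP/and3P => [[b' + /flatten_mapP[i' + /mapP[j']]] | []].
  by rewrite !mem_iota !add1n !ltnS => ? ? ? [-> -> ->].
move=> b_ok i_ok j_ok; exists b; rewrite ?mem_iota ?add1n ?ltnS //.
apply/flatten_mapP; exists i; rewrite ?mem_iota ?add1n ?ltnS //.
by apply: map_f; rewrite mem_iota add1n ltnS.
Qed.

(* The Schur module is defined for any finite set [D] of boxes and depends only on
   how [D] is cut into rows. Hence it applies to the diagram of a partition
   with its last box of a row removed, in the original block coordinates. *)
Definition row_len (D : {fset box}) (r : nat * nat) : nat :=
  #|[set c : D | brow (val c) == r]|.

Notation filling D n := {ffun D -> 'I_n}.

(* The formal linear combinations of fillings of [D], and their basis. *)
Definition fmod (K : fieldType) (D : {fset box}) (n : nat) : vectType K :=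
  {ffun filling D n -> K^o}.

Definition fbas (K : fieldType) (D : {fset box}) (n : nat) (T : filling D n) :
  fmod K D n := [ffun S : filling D n => (S == T)%:R : K^o].

Definition fext (K : fieldType) (D : {fset box}) (n : nat) (W : vectType K)
    (f : filling D n -> W) : 'Hom(fmod K D n, W) :=
  linfun (fun t : {ffun filling D n -> K^o} => \sum_T (t T : K) *: f T).

Lemma fext_bas (K : fieldType) (D : {fset box}) (n : nat) (W : vectType K)
    (f : filling D n -> W) (T : filling D n) :
  fext f (fbas K T) = f T.
Proof.
pose F (t : fmod K D n) := \sum_T ((t : {ffun filling D n -> K^o}) T : K) *: f T.
have linF : linear F.
  move=> a t u; rewrite /F scaler_sumr -big_split /=; apply: eq_bigr => S _.
  by rewrite !ffunE scalerA -scalerDl.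
pose FL := GRing.isLinear.Build K _ _ _ F linF.
pose F' : {linear _ -> _} := HB.pack F FL.
have -> : fext f = linfun F' by [].
rewrite lfunE /= /F (bigD1 T) //= ffunE eqxx scale1r big1 ?addr0 // => S neq.
by rewrite ffunE (negPf neq) scale0r.
Qed.

Lemma fmod_sum (K : fieldType) (D : {fset box}) (n : nat) (t : fmod K D n) :
  t = \sum_T ((t : {ffun filling D n -> K^o}) T : K) *: fbas K T.
Proof.
apply/ffunP => S; rewrite sum_ffunE (bigD1 S) //= !ffunE eqxx big1 => [|T neq].
  by rewrite addr0 [RHS]mulr1.
by rewrite !ffunE eq_sym (negPf neq) [LHS]mulr0.
Qed.

(* [g] sends the tensor product of the [e_(T x)] to that of the
   [g e_(T x)], which is expanded here in the basis of fillings. *)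
Definition fact (K : fieldType) (V : vectType K) (n : nat) (e : n.-tuple V)
    (D : {fset box}) (g : 'End(V)) : 'End(fmod K D n) :=
  fext (fun T : filling D n => \sum_(S : filling D n)
    (\prod_(x : D) coord e (S x) (g (tnth e (T x)))) *: fbas K S).

Definition fperm (D : {fset box}) (n : nat) (s : {perm D}) (T : filling D n) :
  filling D n := [ffun x => T ((s^-1)%g x)].

Definition row_equiv (D : {fset box}) (n : nat) (T1 T2 : filling D n) : bool :=
  [exists s : {perm D},
     [forall x, brow (val (s x)) == brow (val x)] && (T2 == fperm s T1)].

Definition width (D : {fset box}) (A : {set D}) : nat :=
  \max_(x in A) row_len D (brow (val x)).

Definition gsum (K : fieldType) (D : {fset box}) (n : nat) (A : {set D})
    (T : filling D n) : fmod K D n :=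
  \sum_(s : {perm D} | perm_on A s) fbas K (fperm s T).

Definition rels (K : fieldType) (D : {fset box}) (n : nat) :
    {vspace fmod K D n} :=
  (<<[seq fbas K p.1 - fbas K p.2 | p : filling D n * filling D n
        in [pred p | row_equiv p.1 p.2]]>>
   + <<[seq gsum K p.1 p.2 | p : {set D} * filling D n
          in [pred p | (width p.1 < #|p.1|)%N]]>>)%VS.

Definition schur (K : fieldType) (D : {fset box}) (n : nat) : vectType K :=
  quot (rels K D n).

Definition schur_proj (K : fieldType) (D : {fset box}) (n : nat) :
  'Hom(fmod K D n, schur K D n) := qproj (rels K D n).

Definition schur_act (K : fieldType) (V : vectType K) (n : nat)
    (e : n.-tuple V) (D : {fset box}) (g : 'End(V)) : 'End(schur K D n) :=
  qmap (rels K D n) (rels K D n) (fact e D g).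

Lemma fact_perm (K : fieldType) (V : vectType K) (n : nat) (e : n.-tuple V)
    (D : {fset box}) (g : 'End(V)) (s : {perm D}) (T : filling D n) :
  fact e D g (fbas K (fperm s T)) =
  \sum_(S : filling D n) (\prod_(x : D) coord e (S x) (g (tnth e (T x))))
     *: fbas K (fperm s S).
Proof.
rewrite fext_bas.
have fpermK : cancel (@fperm D n s) (@fperm D n (s^-1)%g).
  by move=> S; apply/ffunP => x; rewrite !ffunE invgK permK.
rewrite (reindex_inj (can_inj fpermK)) /=; apply: eq_bigr => S _; congr (_ *: _).
rewrite (reindex_inj (@perm_inj _ s)) /=; apply: eq_bigr => x _.
by rewrite !ffunE permK.
Qed.

Lemma fact_rels (K : fieldType) (V : vectType K) (n : nat) (e : n.-tuple V)
    (D : {fset box}) (g : 'End(V)) :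
  (fact e D g @: rels K D n <= rels K D n)%VS.
Proof.
have perm1 : forall T : filling D n, T = fperm 1%g T.
  by move=> T; apply/ffunP => x; rewrite ffunE invg1 perm1.
rewrite limgD subv_add; apply/andP; split; rewrite limg_span.
  apply: (subv_trans _ (addvSl _ _)); apply/span_subvP => _ /mapP[_ /imageP[[T1 T2] + ->] ->].
  case/existsP=> s /andP[rs /= /eqP->].
  rewrite linearB /= {1}[T1]perm1 !fact_perm -sumrB; apply: memv_suml => S _.
  rewrite -scalerBr memvZ // -perm1 memv_span //; apply/imageP.
  exists (S, fperm s S) => //; apply/existsP; exists s; rewrite eqxx andbT; exact: rs.
apply: (subv_trans _ (addvSr _ _)); apply/span_subvP => _ /mapP[_ /imageP[[A T] + ->] ->].
rewrite inE /= => wA; rewrite linear_sum /=.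
under eq_bigr => s _ do rewrite fact_perm.
rewrite exchange_big /=; apply: memv_suml => S _; rewrite -scaler_sumr.
by rewrite memvZ // memv_span //; apply/imageP; exists (A, S).
Qed.

Lemma schur_actE (K : fieldType) (V : vectType K) (n : nat) (e : n.-tuple V)
    (D : {fset box}) (g : 'End(V)) (t : fmod K D n) :
  schur_act e D g (schur_proj K D n t) = schur_proj K D n (fact e D g t).
Proof. by rewrite qmapE ?fact_rels. Qed.

Definition box_x1 (w : nat -> nat) (b1 : nat) : box := (b1, 1, w b1)%N.
Definition box_y1 (N : nat) : box := (N.+1, 1, 1)%N.

Notation ediagram N w h := (box_y1 N |` diagram N w h).

Definition set_X (N : nat) (w h : nat -> nat) (b1 : nat) :
  {set ediagram N w h} := [set c | val c == box_x1 w b1].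
Definition set_Y (N : nat) (w h : nat -> nat) : {set ediagram N w h} :=
  [set c | val c == box_y1 N].

Definition evac_route (N : nat) (w h : nat -> nat) (b1 : nat)
    (R : {set ediagram N w h}) : bool :=
  [&& R \subset ~: set_Y N w h,
      [exists c in R, brow (val c) == (b1, 1%N)],
      [forall c in R, forall c' in R,
         (brow (val c) == brow (val c')) ==> (c == c')]
    & [forall c in R, forall k : 'I_(idx (val c)),
         (0 < k)%N ==>
         [exists c' in R, brow (val c') == (blk (val c), k : nat)]]].

(* A 1-path is the pair of its map [PR.1] and its evacuation route [PR.2].
   [fconnect PR.1 x c] says that [c] is an iterated image of [x]. *)
Definition one_path (N : nat) (w h : nat -> nat) (b1 : nat)
    (PR : {ffun ediagram N w h -> ediagram N w h} * {set ediagram N w h}) :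
    bool :=
  let: (P, R) := PR in
  let X := set_X N w h b1 in
  let Y := set_Y N w h in
  let R1 := [set c | [exists x in X, fconnect P x c]] in
  [&& evac_route b1 R,
      [forall c, box_le (val c) (val (P c))],
      [forall c in R, box_lt (val c) (val (P c))],
      Y \subset R1, R :|: X :|: Y == R1,
      [forall c in R, forall c' in R,
         [&& blk (val c) == blk (val c'), (idx (val c) < idx (val c'))%N,
             blk (val (P c)) == blk (val c)
           & blk (val (P c')) == blk (val c)]
         ==> box_lt (val (P c)) (val (P c'))],
      [forall c in ~: (R :|: X), P c == c]
    & P @: (R :|: X) == (R :\: X) :|: Y].

Definition path_height (N : nat) (w h : nat -> nat)
    (R : {set ediagram N w h}) : nat :=
  size (undup [seq brow (val c) | c <- enum R]).

Definition hook (w h : nat -> nat) (b : nat) : nat :=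
  (w b - w b.-1 + h b.-1)%N.

Definition hook_sum (w h : nat -> nat) (b1 b : nat) : nat :=
  \sum_(b1.+1 <= j < b.+1) hook w h j.

(* The factor of the block [b1] is [1]. *)
Definition path_weight (N : nat) (w h : nat -> nat) (b1 : nat)
    (R : {set ediagram N w h}) : nat :=
  \prod_(b1.+1 <= b < N.+1)
    (if [exists c in R, blk (val c) == b] then hook_sum w h b1 b else 1%N).

(* The box of the diagram that [P] maps to [c]; on a 1-path there is exactly
   one for every box [c] other than [x_1]. *)
Definition path_source (N : nat) (w h : nat -> nat)
    (P : {ffun ediagram N w h -> ediagram N w h}) (c : box) :
    option (diagram N w h) :=
  [pick d : diagram N w h | val (P (fincl (fsubsetU1 _ _) d)) == c].

Definition path_entry (K : fieldType) (V : vectType K) (n : nat)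
    (e : n.-tuple V) (N : nat) (w h : nat -> nat)
    (P : {ffun ediagram N w h -> ediagram N w h})
    (T : filling (diagram N w h) n) : V :=
  if path_source P (box_y1 N) is Some d then tnth e (T d) else 0.

(* The default value of [odflt] is not used when [P] is a 1-path. *)
Definition path_filling (n N : nat) (w h : nat -> nat) (b1 : nat)
    (P : {ffun ediagram N w h -> ediagram N w h})
    (T : filling (diagram N w h) n) :
    filling (diagram N w h `\ box_x1 w b1) n :=
  [ffun c => T (odflt (fincl (fsubD1set _ _) c) (path_source P (val c)))].

Definition Phi1 (K : fieldType) (V : vectType K) (n : nat) (e : n.-tuple V)
    (N : nat) (w h : nat -> nat) (b1 : nat) :
    'Hom(fmod K (diagram N w h) n,
         tens V (fmod K (diagram N w h `\ box_x1 w b1) n)) :=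
  fext (fun T : filling (diagram N w h) n =>
    \sum_(PR : {ffun ediagram N w h -> ediagram N w h} * {set ediagram N w h}
           | one_path b1 PR)
      ((-1) ^+ path_height PR.2 / (path_weight b1 PR.2)%:R) *:
      tmul (path_entry e PR.1 T) (fbas K (path_filling b1 PR.1 T))).

(* Main.v *)
From HB Require Import structures.
Require Import Defs.
From mathcomp Require Import all_boot all_order all_fingroup all_algebra.
From mathcomp Require Import finmap boolp functions reals complex.
From mathcomp Require Import ssrAC zify ring.

Set Implicit Arguments.
Unset Strict Implicit.
Unset Printing Implicit Defensive.

Import Order.TTheory GRing.Theory Num.Theory.
Local Open Scope fset_scope.
Local Open Scope ring_scope.

(** Why the theorem is true.

    Modulo row permutations a filling is a monomial: it is determined by its
    content, which records how often each entry occurs in each row. On monomials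
    there are the polarization operators E_pq (p, q rows) that move one entry
    from row p to row q in all possible ways; they satisfy the commutation
    relations of a general linear Lie algebra whose index set is the set of
    rows. The row of the extra box y_1 is treated as one more row, which carries
    the tensor factor V.

    In characteristic zero the remaining relations defining the Schur module are
    equivalent to the vanishing of the images of E_pq for p above q: by
    averaging, every symmetrizer G_A with more than w_A boxes reduces to the
    ones where A is a full row together with one box of a lower row
    ([gsum_map_kill]), and such a G_A is, up to a nonzero factor, E_pq applied
    to the filling whose row p has one box more ([exchange_sum]).

    The conditions on a 1-path say that it is determined by its evacuation
    route, along which it moves entries from each row to the next one. Hence,
    with r_1 = [b_1](1) < r_2 < ... < r_m running over the rows of evacuation
    routes, Phi_1 is the operator
      sum of (-1)^m / H times E_(r_1 r_2) E_(r_2 r_3) ... E_(r_m y).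
    It is convenient to transpose: operators act on functions of contents, and
    a composition is read from left to right. The function [mu_class] sending a
    content of mu (with one more entry in row y) to its class in the tensor
    product of V and the Schur module of mu is killed by E_pq whenever row p of
    mu is at least as long as row q, and is an eigenvector of every E_pp. Since
    [Phi_class], its image under the sum above, sends the content of T to the
    class of Phi_1(T) ([Phi_eval]), the inclusion to be proved says that
    [Phi_class] is killed by E_pq for p above q in lambda. As these operators
    are generated by those with p just above q, it suffices to treat adjacent
    rows ([Phi_class_next]).

    This is a computation with commutators ([block_sum_kill]). If both rows lie
    in one block the terms cancel in pairs ([block_sum_inner]). If they are the
    top row of a block b and the bottom row of block b + 1, all terms reduce to
    one common term ([sweep_cross], [climb_jump]), and its coefficient is zero
    exactly because H(b + 1) - H(b) = w_(b+1) - w_b + h_b.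

    Equivariance holds term by term, because each 1-path acts by a bijection
    from the boxes of lambda to those of mu and y_1 ([path_equivariant]). *)

(** * Chains of row operators *)

(** The label [(b, i)] of the row [b](i). *)
Notation row_index := (nat * nat)%type.

(** Abstract operators [D a b] satisfying the relations of the E_ab, transposed:
    [D c d (D a b f)] is the result of applying to [f] first E_ab, then E_cd on
    its right. *)
Section RowOperators.

Variables (K : fieldType) (U : lmodType K) (D : row_index -> row_index -> {linear U -> U}).
Hypothesis D_comm : forall (a b c d : row_index) (f : U),
  D c d (D a b f) = D a b (D c d f) + (if a == d then D c b f else 0)
                    - (if b == c then D a d f else 0).
Variables (N : nat) (w h : nat -> nat) (c : nat -> K).

(** A chain that has entered block [b] at its bottom row goes on to row [k + 1], row by row. *)
Fixpoint climb (b k : nat) (f : U) : U :=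
  if k is k'.+1 then D (b, k'.+1) (b, k'.+2) (climb b k' f) else f.

(** The sum, over all ways of continuing a chain whose current last row is [a] through the
    [t] blocks starting at [b] and then to row y, which is [(b + t, 1)].
    In each block either nothing is selected or the [k + 1] lowest rows. *)
Fixpoint sweep (t b : nat) (f : U) (a : row_index) : U :=
  if t is t'.+1 then
    sweep t' b.+1 f a
    + c b *: \sum_(k < h b) (-1) ^+ k.+1 *:
        sweep t' b.+1 (climb b k (D a (b, 1%N) f)) (b, k.+1)
  else D a (b, 1%N) f.

(** The operator [sweep] for the block in which the chain starts: at least one of its rows
    is selected, and the coefficient of the block is 1. *)
Definition block_sum (t b : nat) (g : U) : U :=
  \sum_(k < h b) (-1) ^+ k.+1 *: sweep t b.+1 (climb b k g) (b, k.+1).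

Definition valid_row (p : row_index) : bool :=
  [&& (0 < p.1 <= N)%N & (0 < p.2 <= h p.1)%N].

(** The function [f] behaves like a highest weight vector with respect to the rows in
    blocks [b] and above, apart from the row [x]: there the weight is one less, and operators
    out of [x] are not controlled. This is what remains true of the class function of
    mu, where [x] is the row of the removed box, and of its images along a chain, where [x] is
    the row that the chain has just reached. *)
Definition highest_above (b : nat) (x : row_index) (f : U) : Prop :=
  (forall p q, valid_row p -> valid_row q -> (b <= q.1 <= p.1)%N -> p != q ->
     p != x -> D p q f = 0)
  /\ (forall p, valid_row p -> (b <= p.1)%N ->
     D p p f = ((w p.1)%:R - (p == x)%:R) *: f).

Lemma D_commute (a b x y : row_index) (f : U) :
  a != y -> b != x -> D x y (D a b f) = D a b (D x y f).
Proof. by move=> /negPf ay /negPf bx; rewrite D_comm ay bx addr0 subr0. Qed.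

Lemma climb0 b k : climb b k 0 = 0.
Proof. by elim: k => //= k ->; rewrite linear0. Qed.

Lemma climbZ b k x f : climb b k (x *: f) = x *: climb b k f.
Proof. by elim: k => //= k ->; rewrite linearZ. Qed.

Lemma climbD b k f g : climb b k (f + g) = climb b k f + climb b k g.
Proof. by elim: k => //= k ->; rewrite linearD. Qed.

Lemma climb_stop b k f : D (b, 1%N) (b, 2%N) f = 0 -> climb b k.+1 f = 0.
Proof.
move=> f0; elim: k => [//|k IHk].
by rewrite -[LHS]/(D (b, k.+2) (b, k.+3) (climb b k.+1 f)) IHk linear0.
Qed.

Lemma sweepD t b f g a : sweep t b (f + g) a = sweep t b f a + sweep t b g a.
Proof.
elim: t b f g a => [|t IHt] b f g a /=; first by rewrite linearD.
rewrite IHt addrACA -scalerDr; congr (_ + _ *: _).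
rewrite -big_split /=; apply: eq_bigr => k _.
by rewrite -scalerDr -IHt -climbD -linearD.
Qed.

Lemma sweepZ t b x f a : sweep t b (x *: f) a = x *: sweep t b f a.
Proof.
elim: t b f a => [|t IHt] b f a /=; first by rewrite linearZ.
rewrite IHt scalerDr; congr (_ + _); rewrite scalerA mulrC -scalerA.
congr (_ *: _); rewrite scaler_sumr; apply: eq_bigr => k _.
by rewrite linearZ climbZ IHt !scalerA mulrC.
Qed.

Lemma sweep0 t b a : sweep t b 0 a = 0.
Proof. by rewrite -(scale0r (0 : U)) sweepZ !scale0r. Qed.

Lemma sweepS t b f a :
  sweep t.+1 b f a = sweep t b.+1 f a + c b *: block_sum t b (D a (b, 1%N) f).
Proof. by []. Qed.

Lemma block_sum0 t b : block_sum t b 0 = 0.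
Proof. by rewrite /block_sum big1 // => k _; rewrite climb0 sweep0 scaler0. Qed.

Lemma climb_commute b k p q g :
  (forall j, (1 < j <= k.+1)%N -> p != (b, j)) ->
  (forall j, (0 < j <= k)%N -> q != (b, j)) ->
  D p q (climb b k g) = climb b k (D p q g).
Proof.
elim: k => [//|k IHk] pk qk /=; rewrite D_commute.
- rewrite IHk // => j /andP[j0 jk]; [apply: pk | apply: qk]; lia.
- by rewrite eq_sym qk //; lia.
- by rewrite eq_sym pk //; lia.
Qed.

(** Operators between rows below block [b] commute with everything that [sweep] does,
    except that they can change the row from which the chain is continued. *)
Lemma sweep_lower t b p q f a : (p.1 < b)%N -> (q.1 < b)%N ->
  D p q (sweep t b f a)
  = sweep t b (D p q f) a + (if a == q then sweep t b f p else 0).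
Proof.
elim: t b f a => [|t IHt] b f a pb qb.
  rewrite /= D_comm; have -> : ((b, 1%N) == p) = false.
    by apply/eqP=> e; move: pb; rewrite -e ltnn.
  by rewrite subr0.
rewrite [LHS]linearD linearZ /= IHt ?ltnS 1?ltnW // linear_sum /=.
have -> : \sum_(k < h b) D p q ((-1) ^+ k.+1 *:
      sweep t b.+1 (climb b k (D a (b, 1%N) f)) (b, k.+1))
    = block_sum t b (D a (b, 1%N) (D p q f))
      + (if a == q then block_sum t b (D p (b, 1%N) f) else 0).
  have bp j : p != (b, j) by apply/eqP=> e; move: pb; rewrite e ltnn.
  have bq j : q != (b, j) by apply/eqP=> e; move: qb; rewrite e ltnn.
  have -> : (if a == q then block_sum t b (D p (b, 1%N) f) else 0)
    = \sum_(k < h b) (-1) ^+ k.+1 *: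
        sweep t b.+1 (climb b k (if a == q then D p (b, 1%N) f else 0)) (b, k.+1).
    by case: ifP => // _; rewrite -/(block_sum t b 0) block_sum0.
  rewrite -big_split /=; apply: eq_bigr => k _; rewrite linearZ -scalerDr /=.
  congr (_ *: _); rewrite IHt ?ltnS 1?ltnW //.
  rewrite [_ == q]eq_sym (negPf (bq _)) addr0 -sweepD -climbD; congr (sweep _ _ _ _).
  rewrite climb_commute // D_comm [_ == p]eq_sym (negPf (bp _)) subr0.
  by case: ifP.
case: eqP => _; last by rewrite !addr0.
by rewrite scalerDr addrACA.
Qed.

Lemma block_sum_lower t b p q g : (p.1 < b)%N || (p == (b, 1%N)) -> (q.1 < b)%N ->
  D p q (block_sum t b g) = block_sum t b (D p q g).
Proof.
move=> pb qb; rewrite linear_sum; apply: eq_bigr => k _; rewrite linearZ /=.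
congr (_ *: _).
have pb' : (p.1 < b.+1)%N by case/orP: pb => [/ltnW //|/eqP->] /=; rewrite ltnS.
have bq j : q != (b, j) by apply/eqP=> e; move: qb; rewrite e ltnn.
rewrite sweep_lower ?pb' 1?ltnW // [_ == q]eq_sym (negPf (bq _)) addr0.
rewrite climb_commute // => j /andP[j1 _].
case/orP: pb => [pb|/eqP->]; first by apply/eqP=> e; move: pb; rewrite e ltnn.
by apply/eqP=> -[e]; move: j1; rewrite -e.
Qed.

(** Entering block [b] uses up one entry of its lowest row, and leaves the rows
    above intact. *)
Lemma highest_above_step b x a f : (a.1 < b)%N -> (x.1 < b)%N -> highest_above b x f ->
  highest_above b (b, 1%N) (D a (b, 1%N) f).
Proof.
move=> ab xb [f0 fw].
have neq p : (b <= p.1)%N -> (a == p) = false.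
  by move=> bp; apply/eqP=> e; move: ab; rewrite e ltnNge bp.
have neqx p : (b <= p.1)%N -> (p == x) = false.
  by move=> bp; apply/eqP=> e; move: xb; rewrite -e ltnNge bp.
split=> [p q pv qv /andP[bq qp] pq pb|p pv bp].
  rewrite D_comm neq // [_ == p]eq_sym (negPf pb) addr0 subr0 f0 ?linear0 ?bq //.
  by rewrite neqx // (leq_trans bq).
rewrite D_comm neq // addr0 fw // neqx // subr0 linearZ /= [_ == p]eq_sym.
by case: eqP => [->|_]; rewrite /= scalerBl ?scale1r ?scale0r.
Qed.

Lemma highest_above_weak b b' x x' f : (b <= b')%N -> (x.1 < b')%N -> (x'.1 < b')%N ->
  highest_above b x f -> highest_above b' x' f.
Proof.
move=> bb xb xb' [f0 fw].
have neqx y p : (y.1 < b')%N -> (b' <= p.1)%N -> (p == y) = false.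
  by move=> yb bp; apply/eqP=> e; move: yb; rewrite -e ltnNge bp.
split=> [p q pv qv /andP[bq qp] pq _|p pv bp].
  by rewrite f0 // ?(leq_trans bb) // neqx // (leq_trans bq).
by rewrite fw ?(leq_trans bb) // !neqx.
Qed.

Lemma highest_above_climb b k x y g : (x.1 <= b)%N -> (y.1 <= b)%N -> highest_above b x g ->
  highest_above b.+1 y (climb b k g).
Proof.
move=> xb yb gg; have [g0 gw] := @highest_above_weak b b.+1 x y g (leqnSn b) xb yb gg.
have neq j (p : row_index) : (b < p.1)%N -> p != (b, j).
  by move=> bp; apply/eqP=> e; move: bp; rewrite e ltnn.
split=> [p q pv qv bqp pq py|p pv bp].
  have /andP[bq qp] := bqp.
  rewrite climb_commute ?g0 ?climb0 // => j _; apply: neq => //.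
  exact: leq_trans qp.
by rewrite climb_commute ?gw ?climbZ // => j _; apply: neq.
Qed.

Section Block.

Variables (b : nat) (g : U).
Hypotheses (b_ok : (0 < b <= N)%N) (gg : highest_above b (b, 1%N) g).

Let neq2 (i j : nat) : i != j -> ((b, i) : row_index) != (b, j).
Proof. by apply: contra => /eqP[->]. Qed.

Let vrow i : (0 < i <= h b)%N -> valid_row (b, i).
Proof. by rewrite /valid_row /= b_ok. Qed.

Let g_kill i j : (1 < i <= h b)%N -> (0 < j <= h b)%N -> i != j ->
  D (b, i) (b, j) g = 0.
Proof.
move=> ib jb ij; apply: gg.1; rewrite ?vrow ?neq2 ?leqnn //=; lia.
Qed.

Lemma climb_weight k : (k < h b)%N ->
  D (b, k.+1) (b, k.+1) (climb b k g) = ((w b)%:R - 1) *: climb b k g.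
Proof.
case: k => [|k] kh /=; first by rewrite gg.2 ?vrow //= eqxx.
rewrite D_comm (negPf (neq2 _)) ?eqxx ?addr0 // ?neq_ltn ?ltnS ?leqnn //.
rewrite climb_commute => [|j jk|j jk]; try by apply: neq2; lia.
by rewrite gg.2 ?vrow //= climbZ linearZ /= (negPf (neq2 _)) // subr0 scalerBl scale1r.
Qed.

(** A chain that stops at row [k + 1] is affected by the lowering operator from row [i + 2] to
    row [i + 1] only if [k = i + 1]. For [k] larger, the commutator contains an
    operator between two rows of the block which the chain has not yet touched, and that
    kills [g]. *)
Lemma climb_down i k : (i.+1 < h b)%N -> (k < h b)%N ->
  D (b, i.+2) (b, i.+1) (climb b k g) = (k == i.+1)%:R *: climb b i g.
Proof.
move=> ih kh; have [ki|ki] := leqP k i.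
  rewrite climb_commute => [|j jk|j jk]; try by apply: neq2; lia.
  have -> : (k == i.+1) = false by lia.
  by rewrite scale0r g_kill ?climb0 //; lia.
rewrite -(subnK ki) in kh *; move: (k - i.+1)%N kh => {ki} {}k.
(* The weights of the two rows differ by exactly one at this point:
   the chain has entered row i + 1, but not yet row i + 2. *)
have base : D (b, i.+2) (b, i.+1) (climb b i.+1 g) = climb b i g.
  rewrite /= D_comm !eqxx.
  rewrite climb_commute => [|j jk|j jk]; try by apply: neq2; lia.
  rewrite g_kill ?climb0 ?linear0 ?add0r; try lia.
  rewrite climb_commute => [|j jk|j jk]; try by apply: neq2; lia.
  rewrite gg.2 ?vrow //= climb_weight; last lia.
  rewrite climbZ (negPf (neq2 _)) // subr0 -scalerBl.
  by rewrite [X in X *: _](_ : _ = 1) ?scale1r //; ring.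
elim: k => [|k IHk] kh; first by rewrite add0n eqxx scale1r base.
rewrite gtn_eqF ?scale0r; last lia.
rewrite addSn /= D_commute; try by apply: neq2; lia.
rewrite IHk; last lia.
case: k {IHk} kh => [|k] kh; last by rewrite gtn_eqF ?scale0r ?linear0 //; lia.
rewrite add0n eqxx scale1r climb_commute => [|j jk|j jk]; try by apply: neq2; lia.
by rewrite g_kill ?climb0 //; lia.
Qed.

(** A chain may skip the rows between [k + 1] and the top row of the block at the price of a
    sign for each skipped row: E_qr is the commutator of E_(q+1)r and E_q(q+1), and
    the first of these kills [g]. *)
Lemma climb_jump j k : h b = (k + j).+2 ->
  D (b, k.+1) (b, h b) (climb b k g) = (-1) ^+ j *: climb b (h b).-1 g.
Proof.
elim: j k => [|j IHj] k hb; first by rewrite hb addn0 expr0 scale1r.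
have := IHj k.+1; rewrite addSnnS => /(_ hb) IH.
rewrite exprS mulN1r scaleNr -IH /= D_comm eqxx (negPf (neq2 _)) ?addr0; last lia.
rewrite [in RHS]climb_commute => [|i ik|i ik]; try by apply: neq2; lia.
by rewrite g_kill ?climb0 ?linear0 ?sub0r ?opprK //; lia.
Qed.

(** The terms that end in row [i + 1] and in row [i + 2] become equal
    up to sign, and all others vanish. *)
Lemma block_sum_inner t i : (i.+1 < h b)%N ->
  D (b, i.+2) (b, i.+1) (block_sum t b g) = 0.
Proof.
move=> ih; rewrite linear_sum /=.
have -> : \sum_(k < h b) D (b, i.+2) (b, i.+1)
      ((-1) ^+ k.+1 *: sweep t b.+1 (climb b k g) (b, k.+1))
    = \sum_(k < h b) ((if k == i.+1 :> nat then
          (-1) ^+ i.+2 *: sweep t b.+1 (climb b i g) (b, i.+2) else 0)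
       + (if k == i :> nat then
          (-1) ^+ i.+1 *: sweep t b.+1 (climb b i g) (b, i.+2) else 0)).
  apply: eq_bigr => k _; rewrite linearZ sweep_lower ?ltnSn //= climb_down // scalerDr.
  congr (_ + _).
    by case: eqP => [->|_]; rewrite ?scale1r // scale0r sweep0 scaler0.
  have -> : ((b, k.+1) == (b, i.+1)) = (k == i :> nat).
    by rewrite xpair_eqE eqxx eqSS.
  by case: eqP => [->|_] //; rewrite scaler0.
rewrite big_split /= -!big_mkcond /=.
rewrite (big_pred1 (Ordinal ih)) ?(big_pred1 (Ordinal (ltnW ih))) //.
by rewrite exprS mulN1r scaleNr addNr.
Qed.

End Block.

(** The operator from the bottom row of block [b + 1] to a row of block [b], moved past the
    sum over the continuations in block [b + 1]. Chains that select two or more rows of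
    that block contribute nothing new, because the operator between its two lowest rows can be
    moved to [f]. *)
Lemma sweep_cross t b i x f a : (b < N)%N -> (0 < h b.+1)%N -> (x.1 <= b)%N ->
  (a.1 <= b)%N -> highest_above b.+1 x f ->
  D (b.+1, 1%N) (b, i) (sweep t.+1 b.+1 f a)
  = sweep t.+1 b.+1 (D (b.+1, 1%N) (b, i) f) a
    + c b.+1 *: sweep t b.+2 (D a (b, i) f) (b.+1, 1%N)
    + (if a == (b, i) then (1 - c b.+1 * (w b.+1)%:R) *: sweep t b.+2 f (b.+1, 1%N)
       else 0).
Proof.
move=> bN hb xb ab gf; set r := (b, i); set r' := (b.+1, 1%N).
have [f0 fw] := gf.
have vr' : valid_row r' by rewrite /valid_row /= hb bN.
have neqb p j : (p.1 <= b)%N -> (p == (b.+1, j)) = false.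
  by move=> pb; apply/eqP=> e; move: pb; rewrite e ltnn.
have neqr p : (b < p.1)%N -> (p == r) = false.
  by move=> pb; apply/eqP=> e; move: pb; rewrite e ltnn.
pose s g k := (-1) ^+ k.+1 *: sweep t b.+2 (climb b.+1 k g) (b.+1, k.+1).
have step : D r' r (block_sum t b.+1 (D a r' f))
    = block_sum t b.+1 (D a r' (D r' r f))
      + sweep t b.+2 (D a r f) r'
      - (if a == r then (w b.+1)%:R *: sweep t b.+2 f r' else 0).
  (* The summand with one row of the block behaves differently from the others. *)
  have s0 (g : U) : block_sum t b.+1 g
      = - sweep t b.+2 g r' + \sum_(k < h b.+1 | (0 < k)%N) s g k.
    rewrite /block_sum (bigD1 (Ordinal hb)) //= expr1 scaleN1r; congr (_ + _).
    by apply: eq_bigl => k; rewrite lt0n.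
  rewrite !s0 linearD linearN /= linear_sum /=.
  have -> : \sum_(k < h b.+1 | (0 < k)%N) D r' r (s (D a r' f) k)
            = \sum_(k < h b.+1 | (0 < k)%N) s (D a r' (D r' r f)) k.
    apply: eq_bigr => -[k kh] /= k0; rewrite linearZ /=; congr (_ *: _).
    rewrite sweep_lower ?ltnS //= neqr // addr0; congr (sweep _ _ _ _).
    rewrite climb_commute => [|j jk|j jk]; last 2 first.
    - by apply/eqP=> -[e]; move: jk; rewrite -e.
    - by apply/eqP=> -[e]; move: e; lia.
    rewrite D_comm eqxx climbD climbD -[RHS]addr0 -[RHS]addr0 -!addrA; congr (_ + _).
    have vr2 : valid_row (b.+1, 2%N) by rewrite /valid_row /= bN; lia.
    have f12 : D r' (b.+1, 2%N) f = 0.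
      rewrite f0 /= ?leqnn //; first by rewrite xpair_eqE andbF.
      by apply/eqP=> e; move: xb; rewrite -e ltnn.
    have -> : climb b.+1 k (if a == r then D r' r' f else 0) = 0.
      case: ifP => _; rewrite ?climb0 // fw // climbZ.
      by case: (k) k0 => // k' _; rewrite climb_stop ?scaler0.
    rewrite add0r addr0 -scaleN1r climbZ; case: (k) k0 => // k' _.
    by rewrite climb_stop ?scaler0 // D_commute ?f12 ?linear0 ?neqb //.
  rewrite sweep_lower ?ltnS //= neqr // addr0 D_comm eqxx.
  rewrite !sweepD -scaleN1r sweepZ scaleN1r.
  have -> : sweep t b.+2 (if a == r then D r' r' f else 0) r'
     = (if a == r then (w b.+1)%:R *: sweep t b.+2 f r' else 0).
    case: ifP => _; rewrite ?sweep0 // fw // [r' == x]eq_sym neqb //.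
    by rewrite subr0 sweepZ.
  by rewrite opprB opprD !addrA [LHS](ACl (2*4*1*3)).
rewrite [in LHS]sweepS linearD linearZ /= -/r -/r' step.
rewrite sweep_lower ?ltnS //=.
rewrite -/r' scalerBr !scalerDr -/(block_sum t b.+1 _).
case: ifP => _; last by rewrite scaler0 !addr0 subr0 -!addrA.
by rewrite scalerA scalerBl scale1r !addrA [LHS](ACl (1*3*4*2*5)).
Qed.

(** By [climb_jump], all lengths of the chain inside block [b] lead to the
    same function; the coefficient collects [h b - 1] equal contributions of the shorter
    chains and that of the chain through the full block. *)
Lemma block_sum_cross t b g : (0 < b < N)%N -> (0 < h b)%N -> (0 < h b.+1)%N ->
  highest_above b (b, 1%N) g ->
  D (b.+1, 1%N) (b, h b) (block_sum t.+1 b g)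
  = ((-1) ^+ (h b).-1 * (c b.+1 * ((h b)%:R + (w b.+1)%:R - (w b)%:R) - 1))
    *: sweep t b.+2 (climb b (h b).-1 g) (b.+1, 1%N).
Proof.
move=> /andP[b0 bN] hb hb' gg; set r := (b, h b); set r' := (b.+1, 1%N).
have b_ok : (0 < b <= N)%N by rewrite b0 ltnW.
set S := sweep _ _ _ _; rewrite linear_sum /=.
have Fg : D r' r g = 0.
  apply: gg.1; rewrite /valid_row /= ?b_ok ?bN ?hb ?leqnn ?leqnSn //.
    by apply/eqP=> -[e _]; move: e; lia.
  by apply/eqP=> -[e]; move: e; lia.
pose x := c b.+1; pose z : K := 1 - x * (w b.+1)%:R + x * ((w b)%:R - 1).
have -> : \sum_(k < h b) D r' r
      ((-1) ^+ k.+1 *: sweep t.+1 b.+1 (climb b k g) (b, k.+1))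
    = \sum_(k < h b) (if k.+1 == h b then (-1) ^+ h b * z else - (-1) ^+ h b * x) *: S.
  apply: eq_bigr => -[k kh] _; rewrite linearZ /=.
  rewrite (@sweep_cross t b _ (b, 1%N)) //; last exact: highest_above_climb gg.
  rewrite climb_commute => [|j jk|j jk]; last 2 first.
  - by apply/eqP=> -[]; lia.
  - by apply/eqP=> -[]; lia.
  rewrite Fg climb0 sweep0 add0r xpair_eqE eqxx /= -/x.
  case: eqP => [hk|/eqP hk].
    rewrite /r -{1}hk climb_weight // sweepZ scalerA -scalerDl scalerA hk /S.
    by congr (_ *: sweep _ _ (climb _ _ _) _); rewrite ?/z; [ring | rewrite -hk].
  have hk' : h b = (k + (h b - k.+2)).+2 by lia.
  rewrite (climb_jump b_ok gg hk') sweepZ addr0 !scalerA -/S; congr (_ *: _).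
  rewrite mulrAC -exprD; congr (_ * _).
  have [e1 e2] : (k.+1 + (h b - k.+2) = (h b).-1)%N /\ h b = (h b).-1.+1 by lia.
  by rewrite e1 [in RHS]e2 exprS mulN1r opprK.
rewrite -scaler_suml; congr (_ *: _).
case: (h b) hb => // h' _.
rewrite big_ord_recr /= eqxx.
under eq_bigr => k _ do rewrite eqSS ltn_eqF //.
rewrite sumr_const card_ord -mulr_natl /z -/x -natr1 exprS.
ring.
Qed.

Definition next_row (q p : row_index) : bool :=
  (p == (q.1, q.2.+1)) || (q.2 == h q.1) && (p == (q.1.+1, 1%N)).

Hypothesis h_gt0 : forall b, (1 <= b <= N)%N -> (0 < h b)%N.

(** For rows in a block above [b] this follows by induction on the number of blocks; if
    the lower row is in block [b], the chains through that block are covered by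
    [block_sum_inner] and [block_sum_cross]. In the latter case they cancel against the
    chains that skip block [b]. *)
Lemma sweep_kill b0 t b x f a p q :
  (forall b, (b0 < b <= N)%N -> c b != 0) ->
  (forall b, (b0 < b < N)%N ->
     (c b.+1)^-1 = (c b)^-1 + (h b)%:R + (w b.+1)%:R - (w b)%:R) ->
  (t + b = N.+1)%N -> (b0 < b)%N -> (a.1 < b)%N -> (x.1 < b)%N -> highest_above b x f ->
  valid_row q -> valid_row p -> next_row q p -> (b <= q.1)%N ->
  D p q (sweep t b f a) = 0.
Proof.
case: q p => [q1 q2] [p1 p2] /= c0 cS + + + + + vq vp nqp.
elim: t b x f a => [|t IHt] b x f a tb b0b ab xb gf bq.
  by move: vq; rewrite /valid_row /=; lia.
have b_ok : (0 < b <= N)%N by lia.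
have gg := highest_above_step ab xb gf.
have gf' : highest_above b.+1 x f by apply: highest_above_weak gf; rewrite // ltnS ltnW.
have fpq : b = q1 -> D (p1, p2) (q1, q2) f = 0.
  have [qp pq] : (q1 <= p1)%N /\ (p1, p2) != (q1, q2).
    case/orP: nqp => [|/andP[_]] /eqP[-> ->]; (split; first lia).
    - by apply/eqP=> -[]; lia.
    - by apply/eqP=> -[]; lia.
  move=> e; apply: gf.1 => //=; first by rewrite e leqnn.
  by apply/eqP=> e'; move: xb; rewrite -e' /=; lia.
have aq j : (a == (b, j)) = false by apply/eqP=> e; move: ab; rewrite e ltnn.
rewrite sweepS linearD linearZ /=; move: bq; rewrite leq_eqVlt => /orP[/eqP qb | bq].
  subst q1; have {}fpq := fpq erefl.
  case/orP: nqp => [/eqP[e1 e2] | /andP[/eqP /= e3 /eqP[e1 e2]]]; subst p1 p2.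
    case: q2 {IHt} vq vp fpq => [|i] vq vp fpq; first by move: vq; rewrite /valid_row /= andbF.
    rewrite sweep_lower ?ltnS // aq fpq sweep0 addr0.
    by rewrite block_sum_inner ?scaler0 ?addr0 //; move: vp; rewrite /valid_row /=; lia.
  subst q2; have bN : (b < N)%N by move: vp; rewrite /valid_row /=; lia.
  case: t IHt tb => [|t] _ tb; first lia.
  rewrite (@sweep_cross t b _ x) ?h_gt0 //; try lia.
  rewrite aq fpq sweep0 add0r addr0 block_sum_cross ?h_gt0 //; try lia.
  set S := sweep _ _ (climb _ _ _) _.
  have -> : sweep t b.+2 (D a (b, h b) f) (b.+1, 1%N) = (-1) ^+ (h b).-1 *: S.
    have : (0 < h b)%N by apply: h_gt0.
    rewrite /S -sweepZ; case hb: (h b) => [|[|h']] // _; first by rewrite scale1r.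
    have := @climb_jump b _ b_ok gg h' 0 hb; rewrite hb /= exprS mulN1r scaleNr => <-.
    rewrite D_comm aq eqxx addr0 (gf.1 (b, 1%N)) ?linear0 ?sub0r ?opprK //.
    - by rewrite /valid_row /= b_ok hb.
    - by rewrite /valid_row /= b_ok hb /=.
    - by rewrite /= leqnn.
    - by apply/eqP=> -[].
    - by apply/eqP=> e; move: xb; rewrite -e ltnn.
  (* Here the recursion satisfied by the weights enters. *)
  rewrite !scalerA -scalerDl [X in X *: _](_ : _ = 0) ?scale0r //.
  have cb : c b != 0 by apply: c0; lia.
  have cb' : c b.+1 != 0 by apply: c0; lia.
  have -> : (h b)%:R + (w b.+1)%:R - (w b)%:R = (c b.+1)^-1 - (c b)^-1.
    by rewrite cS; [ring | lia].
  by field; rewrite cb cb'.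
rewrite (IHt b.+1 x) //; try lia.
rewrite linear_sum big1 ?scaler0 ?addr0 // => k _; rewrite linearZ /=.
rewrite (IHt b.+1 x) ?scaler0 //=; try lia.
by apply: highest_above_climb gg; rewrite /= ?leqnn // ltnW.
Qed.

(** The recursion for the inverses of the coefficients [c] is that of H(b), and the initial
    value is fixed by the requirement of the starting block, whose coefficient is 1. *)
Lemma block_sum_kill t b f p q :
  (forall b', (b < b' <= N)%N -> c b' != 0) ->
  (forall b', (b < b' < N)%N ->
     (c b'.+1)^-1 = (c b')^-1 + (h b')%:R + (w b'.+1)%:R - (w b')%:R) ->
  ((b < N)%N -> (c b.+1)^-1 = (h b)%:R + (w b.+1)%:R - (w b)%:R) ->
  (t + b = N)%N -> (0 < b)%N -> highest_above b (b, 1%N) f ->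
  ((q.1 < b)%N -> D p q f = 0) ->
  valid_row q -> valid_row p -> next_row q p ->
  D p q (block_sum t b f) = 0.
Proof.
case: q p => [q1 q2] [p1 p2] /= c0 cS cb tb b0 gf fl vq vp nqp.
have b_ok : (0 < b <= N)%N by lia.
have [qb|bq|e] := ltngtP q1 b.
- rewrite block_sum_lower ?fl ?block_sum0 //=.
  case/orP: nqp => [|/andP[_]] /eqP[-> ->]; first by rewrite qb.
  by rewrite xpair_eqE eqxx andbT orbC -leq_eqVlt.
- rewrite linear_sum big1 // => k _; rewrite linearZ /=.
  rewrite (@sweep_kill b t b.+1 (b, 1%N)) ?scaler0 //= ?addnS ?tb //.
  by apply: highest_above_climb gf; rewrite /= ?leqnn.
subst q1; case/orP: nqp => [/eqP[e1 e2] | /andP[/eqP /= e3 /eqP[e1 e2]]]; subst p1 p2.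
  case: q2 vq vp {fl} => [|i] vq vp; first by move: vq; rewrite /valid_row /= andbF.
  by rewrite block_sum_inner //; move: vp; rewrite /valid_row /=; lia.
subst q2; have bN : (b < N)%N by move: vp; rewrite /valid_row /=; lia.
case: t tb => [|t] tb; first lia.
rewrite block_sum_cross ?h_gt0 ?b0 //; try lia.
rewrite -cb // mulfV ?subrr ?mulr0 ?scale0r //; apply: c0; lia.
Qed.

End RowOperators.

(** * Reduction of the symmetrizers *)

Section Symmetrizers.

Variables (K : fieldType) (W : lmodType K) (D : {fset box}) (n : nat).
Hypothesis char0 : [pchar K] =i pred0.

Implicit Types (A : {set D}) (T : filling D n) (s : {perm D}).

Lemma scale_nat_eq0 (m : nat) (v : W) : (0 < m)%N -> v *+ m = 0 -> v = 0.
Proof.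
move=> m0; rewrite -scaler_nat => /eqP; rewrite scaler_eq0 => /orP[|/eqP //].
by rewrite (pcharf0P K).1 // => /eqP m0'; rewrite m0' in m0.
Qed.

Lemma fpermM s t T : fperm s (fperm t T) = fperm (t * s)%g T.
Proof. by apply/ffunP => x; rewrite !ffunE invMg permM. Qed.

Definition row_set (r : row_index) : {set D} := [set c : D | brow (val c) == r].

(** The value on the symmetrizer G_A(T) of the linear map sending each filling [S] to [G S]. *)
Definition gsum_map (G : filling D n -> W) (A : {set D}) (T : filling D n) : W :=
  \sum_(s : {perm D} | perm_on A s) G (fperm s T).

Lemma sum_perm_preim A x (phi : D -> W) : x \in A ->
  \sum_(s : {perm D} | perm_on A s) phi ((s^-1)%g x)
  = (\sum_(z in A) phi z) *+ #|[set s | perm_on A s & s x == x]|.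
Proof.
move=> xA.
rewrite (partition_big (fun s : {perm D} => (s^-1)%g x) (mem A)) /=; last first.
  move=> s As; rewrite -(perm_closed _ As) permKV //.
rewrite -sumrMnl; apply: eq_bigr => z zA.
under eq_bigr => s /andP[_ /eqP-> ] do over.
rewrite sumr_const; congr (_ *+ _).
have At y : y \in A -> perm_on A (tperm x y).
  move=> yA; apply/subsetP=> u; rewrite inE; apply: contraR => uA.
  by rewrite tpermD //; apply: contraNneq uA => <-.
(* Composing with the transposition of x and z shows that the number of
   permutations sending z to x does not depend on z. *)
have cj : #|[set s : {perm D} | perm_on A s & s x == x]|
   = #|[pred s : {perm D} | perm_on A s & (s^-1)%g x == z]|.
  rewrite -(card_imset _ (mulgI (tperm x z))); apply: eq_card => s; rewrite inE.
  apply/imsetP/andP => [[t + ->] | [As /eqP sx]].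
    rewrite inE => /andP[At' /eqP tx]; split; first by rewrite perm_onM ?At.
    have tVx : (t^-1)%g x = x by rewrite -{1}tx permK.
    by rewrite invMg tpermV permM tVx tpermL.
  exists (tperm x z * s)%g; rewrite ?mulgA ?tperm2 ?mul1g // inE perm_onM ?At //.
  by rewrite permM tpermL -sx permKV /=.
by rewrite cj; apply: eq_card => s; rewrite !inE.
Qed.

Lemma perm_on_mulr A s t : perm_on A s -> perm_on A (t * s)%g = perm_on A t.
Proof.
move=> As; apply/idP/idP => [Ats|At]; last exact: (perm_onM At As).
have As' : perm_on A (s^-1)%g by rewrite perm_onV.
by have := perm_onM Ats As'; rewrite mulgK.
Qed.

Section Reduction.

Variables (rk : row_index -> nat) (G : filling D n -> W).
Hypothesis rk_inj : forall c d : D,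
  rk (brow (val c)) = rk (brow (val d)) -> brow (val c) = brow (val d).
Hypothesis rk_len : forall c d : D, (rk (brow (val c)) <= rk (brow (val d)))%N ->
  (row_len D (brow (val c)) <= row_len D (brow (val d)))%N.
Hypothesis G_row : forall s T,
  (forall x, brow (val (s x)) == brow (val x)) -> G (fperm s T) = G T.
Hypothesis G_exchange : forall (d x : D) T,
  (rk (brow (val x)) < rk (brow (val d)))%N ->
  gsum_map G (x |: row_set (brow (val d))) T = 0.

(** The sum over a group is, up to the order of a subgroup, a sum of sums over
    cosets of that subgroup. *)
Lemma gsum_map_sub (A B : {set D}) T : B \subset A ->
  (forall S, gsum_map G B S = 0) -> gsum_map G A T = 0.
Proof.
move=> BA B0; apply: (@scale_nat_eq0 #|[pred s : {perm D} | perm_on B s]|).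
  by apply/card_gt0P; exists 1%g; rewrite inE perm_on1.
rewrite -sumr_const.
have <- : \sum_(s : {perm D} | perm_on B s) \sum_(t : {perm D} | perm_on A t)
   G (fperm s (fperm t T)) = \sum_(i in [pred s | perm_on B s]) gsum_map G A T.
  apply: eq_big => [s|s Bs]; first by rewrite inE.
  have As : perm_on A s by apply: subset_trans BA.
  rewrite /gsum_map [RHS](reindex_inj (mulIg s)) /=.
  apply: eq_big => [t|t _]; last by rewrite fpermM.
  by rewrite perm_on_mulr.
by rewrite exchange_big big1 // => t _; exact: B0.
Qed.

Lemma gsum_map_perm (A : {set D}) (t : {perm D}) T :
  gsum_map G (t @: A) (fperm t T)
  = \sum_(s : {perm D} | perm_on A s) G (fperm (s * t)%g T).
Proof.
rewrite /gsum_map (reindex_inj (conjg_inj t)) /=; apply: eq_big => [s|s _].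
  apply/idP/idP => [/subsetP As|/subsetP As]; apply/subsetP => x; rewrite inE => sx.
    by rewrite -(mem_imset _ _ (@perm_inj _ t)) As // inE permJ (inj_eq perm_inj).
  by rewrite -(permKV t x) mem_imset ?As ?inE //;
     [rewrite -(inj_eq (@perm_inj _ t)) -permJ permKV | exact: perm_inj].
by rewrite fpermM -conjgC.
Qed.

(** Let [r] be the highest row meeting [A]; it has maximal length. The proof is by induction
    on the number of boxes of [r] outside [A]. If there are none, [A] contains row [r] and a
    box of a lower row. Otherwise add a box [be] of row [r] to [A]. The sum over the larger
    symmetric group splits according to the image y of this box: if y is in row [r] the partial sum
    is G_A(T) up to a row permutation, and otherwise it is a symmetrizer for a set with
    one more box in row [r], so it vanishes by induction, as does the total. So a nonzero
    multiple of G_A(T) vanishes. *)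
Lemma gsum_map_kill A T : (width A < #|A|)%N -> gsum_map G A T = 0.
Proof.
move=> wA; have /card_gt0P[a0 a0A] : (0 < #|A|)%N by apply: leq_ltn_trans wA.
case: (@arg_maxnP _ a0 (mem A) (fun c => rk (brow (val c))) a0A) => d dA dmax.
set r := brow (val d) in dmax.
have rlen (B : {set D}) : d \in B -> (forall c, c \in B -> (rk (brow (val c)) <= rk r)%N) ->
    width B = row_len D r.
  move=> dB Bmax; apply/eqP; rewrite eqn_leq; apply/andP; split.
    by apply/bigmax_leqP => c cB; apply: rk_len; apply: Bmax.
  exact: (@leq_bigmax_cond _ (mem B) (fun c => row_len D (brow (val c)))).
have {}dmax c : c \in A -> (rk (brow (val c)) <= rk r)%N by move=> cA; exact: dmax.
have {}dA : d \in A by [].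
have [m] := ubnP #|row_set r :\: A|.
elim: m A T wA dA dmax {a0 a0A} => // m IHm A T wA dA dmax rAm.
have [/eqP|] := boolP (row_set r :\: A == set0).
  move/eqP; rewrite setD_eq0 => rA; rewrite (rlen A) // in wA.
  have /subsetPn[x xA xr] : ~~ (A \subset row_set r).
    apply: contraL wA => /subset_leq_card; rewrite -leqNgt => /leq_trans; apply.
    by rewrite /row_len leq_eqVlt; apply/orP; left; apply/eqP/eq_card => c; rewrite !inE.
  apply: (@gsum_map_sub _ (x |: row_set r)); first by rewrite subUset sub1set xA.
  move=> S; apply: G_exchange; rewrite ltn_neqAle dmax // andbT.
  by apply: contraNneq xr => /rk_inj; rewrite inE => ->.
case/set0Pn => be; rewrite !inE => /andP[beA /eqP ber].
have IHgt (B : {set D}) S : d \in B -> (forall c, c \in B -> (rk (brow (val c)) <= rk r)%N) ->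
    (#|A| <= #|B|)%N -> row_set r :&: A \subset B -> be \in B -> gsum_map G B S = 0.
  move=> dB Bmax AB rAB beB; apply: IHm => //.
    by rewrite rlen // -(rlen A) //; apply: leq_trans AB.
  rewrite -ltnS; apply: leq_trans rAm; rewrite ltnS; apply: proper_card.
  rewrite properE; apply/andP; split; last first.
    by apply/subsetPn; exists be; rewrite !inE ?ber ?eqxx ?beB // beA.
  apply/subsetP=> c; rewrite !inE => /andP[cB cr]; rewrite cr andbT.
  by apply: contra cB => cA; apply: (subsetP rAB); rewrite !inE cr.
have Bsum : gsum_map G (be |: A) T = 0.
  apply: IHgt; rewrite ?inE ?eqxx ?dA ?orbT ?subset_leq_card ?subsetUr //.
    by move=> c; rewrite !inE => /orP[/eqP->|/dmax //]; rewrite ber.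
  by rewrite (subset_trans (subsetIr _ _)) // subsetUr.
move: Bsum; rewrite /gsum_map.
rewrite (partition_big (fun s : {perm D} => s be) (mem (be |: A))) /=; last first.
  by move=> s Bs; rewrite (perm_closed _ Bs) !inE eqxx.
have inner y : y \in be |: A ->
   \sum_(s : {perm D} | perm_on (be |: A) s && (s be == y)) G (fperm s T)
   = \sum_(s : {perm D} | perm_on A s) G (fperm (s * tperm be y)%g T).
  move=> yB; rewrite (reindex_inj (mulIg (tperm be y))) /=; apply: eq_bigl => s.
  have Bt : perm_on (be |: A) (tperm be y).
    apply/subsetP=> u; rewrite inE; apply: contraR => uB; rewrite tpermD //.
      by apply: contraNneq uB => <-; rewrite !inE eqxx.
    by apply: contraNneq uB => <-.
  rewrite permM (canF_eq (tpermK be y)) tpermR.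
  rewrite (perm_on_mulr _ Bt); apply/andP/idP => [[Bs /eqP sb]|As].
    apply/subsetP=> u su; have := subsetP Bs u su.
    by rewrite !inE => /orP[/eqP ub|//]; move: su; rewrite inE ub sb eqxx.
  split; last by rewrite (out_perm As).
  exact: subset_trans As (subsetUr _ _).
(* Images in row r give copies of the sum over A, the others vanish. *)
rewrite (eq_bigr _ inner) (bigID (mem (row_set r))) /= [X in _ + X]big1 ?addr0.
  rewrite (eq_bigr (fun=> gsum_map G A T)).
    rewrite sumr_const; apply: scale_nat_eq0; apply/card_gt0P; exists be.
    by rewrite -topredE /= !inE ber !eqxx.
  move=> y /andP[_]; rewrite inE => /eqP yr; apply: eq_bigr => s _.
  rewrite -fpermM G_row // => x.
  by case: tpermP => [->|->|_ _]; rewrite ?yr ?ber.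
move=> y /andP[yB yr]; rewrite inE in yr; rewrite -gsum_map_perm.
have yA : y \in A by move: yB yr; rewrite !inE => /orP[/eqP->|//]; rewrite ber eqxx.
have fixd x : brow (val x) = r -> x != be -> tperm be y x = x.
  by move=> xr xb; rewrite tpermD 1?eq_sym //; apply: contraNneq yr => <-; rewrite xr.
apply: IHgt.
- rewrite -(fixd d erefl) ?imset_f //; by apply: contraNneq beA => <-.
- move=> c /imsetP[z zA ->]; by case: tpermP => [_ | _ | _ _]; rewrite ?ber ?dmax.
- by rewrite card_imset //; apply: perm_inj.
- apply/subsetP=> x; rewrite !inE => /andP[/eqP xr xA].
  rewrite -(fixd x xr) ?imset_f //; by apply: contraNneq beA => <-.
- by apply/imsetP; exists y => //; rewrite tpermR.
Qed.

End Reduction.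
End Symmetrizers.

(** * Polarization operators on functions of contents *)

(** Contents have integer values in order to form a group; the contents of fillings
    are among the nonnegative ones. *)
Notation content n := (row_index * 'I_n -> int).

Definition unit_content (n : nat) (r : row_index) (v : 'I_n) : content n :=
  fun x => (x == (r, v))%:R.

Section Polarization.

Variables (K : fieldType) (Q : lmodType K) (n : nat).
Local Notation U := (content n -> Q).
Local Notation one := (@unit_content n).

Definition nonneg (m : content n) : Prop := forall x, 0 <= m x.

(** The transpose of the operator moving one entry from row [a] to row [b]. Cutting it off
    outside the nonnegative contents is compatible with composition, since only entries that
    are present are moved; without the cut-off, contents with an entry -1 in row [b] would
    contribute, and the class function below would not be killed. *)
Definition polar (a b : row_index) (f : U) : U :=
  fun m => if pselect (nonneg m) then
    \sum_v (m (a, v))%:~R *: f (m - one a v + one b v) else 0.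

Lemma polarE a b f m : nonneg m ->
  polar a b f m = \sum_v (m (a, v))%:~R *: f (m - one a v + one b v).
Proof. by rewrite /polar; case: pselect. Qed.

Lemma polar_neg a b f m : ~ nonneg m -> polar a b f m = 0.
Proof. by rewrite /polar; case: pselect. Qed.

Lemma nonneg_move a b v m : nonneg m -> m (a, v) != 0 ->
  nonneg (m - one a v + one b v).
Proof.
move=> m0 mav x.
have -> : (m - one a v + one b v) x = m x - (x == (a, v))%:R + (x == (b, v))%:R by [].
apply: addr_ge0; last by case: eqP.
by have := m0 x; case: eqP => [->|_]; rewrite ?subr0 // subr_ge0 le0r (negPf mav).
Qed.

Lemma polar_is_linear a b : linear (polar a b).
Proof.
move=> x f g; apply/funext => m; rewrite !fctE.
have [m0|m0] := pselect (nonneg m); last by rewrite !polar_neg // scaler0 addr0.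
rewrite !polarE // scaler_sumr -big_split /=; by apply: eq_bigr => v _; rewrite !fctE scalerDr !scalerA mulrC.
Qed.

HB.instance Definition _ a b := GRing.isLinear.Build K U U _ (polar a b) (polar_is_linear a b).

(** Applying the two operators in either order reaches the same contents; the
    multiplicities differ only when the second move takes back the entry that has just been
    moved. *)
Lemma polar_comm (a b c d : row_index) (f : U) :
  polar c d (polar a b f) = polar a b (polar c d f)
    + (if a == d then polar c b f else 0) - (if b == c then polar a d f else 0).
Proof.
apply/funext => m; apply/eqP; rewrite !fctE.
have [m0|m0] := pselect (nonneg m); last first.
  rewrite !polar_neg // add0r; apply/eqP.
  by case: ifP => _; case: ifP => _; rewrite ?polar_neg // subrr.
have E1 : polar c d (polar a b f) m = \sum_u \sum_v
   (m (c, u) * (m (a, v) - ((a, v) == (c, u))%:R + ((a, v) == (d, u))%:R))%:~R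
     *: f (m - one c u + one d u - one a v + one b v).
  rewrite polarE //; apply: eq_bigr => u _.
  have [mcu|mcu] := eqVneq (m (c, u)) 0.
    by rewrite mcu scale0r big1 // => v _; rewrite mul0r scale0r.
  rewrite polarE ?scaler_sumr; last exact: nonneg_move.
  by apply: eq_bigr => v _; rewrite scalerA -intrM.
have E2 : polar a b (polar c d f) m = \sum_u \sum_v
   (m (a, v) * (m (c, u) - ((c, u) == (a, v))%:R + ((c, u) == (b, v))%:R))%:~R
     *: f (m - one c u + one d u - one a v + one b v).
  rewrite exchange_big polarE //=; apply: eq_bigr => v _.
  have [mav|mav] := eqVneq (m (a, v)) 0.
    by rewrite mav scale0r big1 // => u _; rewrite mul0r scale0r.
  rewrite polarE ?scaler_sumr; last exact: nonneg_move.
  apply: eq_bigr => u _; rewrite scalerA -intrM; congr (_ *: f _).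
  by rewrite [LHS](ACl (1*4*5*2*3)).
have E3 : (if a == d then polar c b f else 0 : U) m = \sum_u \sum_v
   (m (c, u) * ((a, v) == (d, u))%:R)%:~R
     *: f (m - one c u + one d u - one a v + one b v).
  case: eqP => [->|/eqP/negPf ad].
    rewrite polarE //; apply: eq_bigr => u _; rewrite (bigD1 u) //= eqxx mulr1 addrK big1 ?addr0 // => v.
    by rewrite xpair_eqE eqxx => /negPf-> /=; rewrite mulr0 scale0r.
  by rewrite big1 // => u _; rewrite big1 // => v _; rewrite xpair_eqE ad mulr0 scale0r.
have E4 : (if b == c then polar a d f else 0 : U) m = \sum_u \sum_v
   (m (a, v) * ((c, u) == (b, v))%:R)%:~R
     *: f (m - one c u + one d u - one a v + one b v).
  rewrite exchange_big /=; case: eqP => [->|/eqP/negPf bc].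
    rewrite polarE //; apply: eq_bigr => v _; rewrite (bigD1 v) //= eqxx mulr1 big1 ?addr0 => [|u].
      by congr (_ *: f _); rewrite [RHS](ACl (1*4*3*(2*5))) /= addNr addr0.
    by rewrite xpair_eqE eqxx => /negPf-> /=; rewrite mulr0 scale0r.
  rewrite big1 // => v _; rewrite big1 // => u _.
  by rewrite xpair_eqE eq_sym bc mulr0 scale0r.
rewrite E1 E2 E3 E4 -subr_eq0 opprD opprK opprD !addrA.
rewrite -!sumrN -!big_split /= big1 // => u _.
rewrite -!sumrN -!big_split /= big1 // => v _.
rewrite -!scaleNr -!scalerDl; apply/eqP; rewrite -!intrN -!intrD.
rewrite [X in X%:~R](_ : _ = 0) ?scale0r // [(c, u) == (a, v)]eq_sym.
case: eqP => [[-> ->]|_] /=; ring.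
Qed.

End Polarization.

(** * Contents of fillings *)

Section Contents.

Variables (n : nat) (D : {fset box}).
Implicit Types (T : filling D n) (s : {perm D}) (m : content n).

Definition box_content T (x : D) : content n := unit_content (brow (val x)) (T x).

Definition content_of T : content n := \sum_(x : D) box_content T x.

Lemma content_ofE T r v :
  content_of T (r, v) = #|[set x : D | (brow (val x) == r) && (T x == v)]|%:R.
Proof.
rewrite /content_of fct_sumE -sumr_const [RHS]big_mkcond; apply: eq_bigr => x _.
by rewrite /box_content /unit_content xpair_eqE inE eq_sym [v == _]eq_sym; case: ifP.
Qed.

Lemma nonneg_unit r (v : 'I_n) : nonneg (unit_content r v).
Proof. by move=> x; rewrite /unit_content; case: eqP. Qed.

Lemma nonnegD m1 m2 : nonneg m1 -> nonneg m2 -> nonneg (m1 + m2).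
Proof. by move=> h1 h2 x; apply: addr_ge0. Qed.

Lemma nonneg_sum (I : Type) (r : seq I) (P : pred I) (F : I -> content n) :
  (forall i, nonneg (F i)) -> nonneg (\sum_(i <- r | P i) F i).
Proof. by move=> F0; apply: big_ind => // m1 m2; apply: nonnegD. Qed.

Lemma nonneg_content T : nonneg (content_of T).
Proof. by apply: nonneg_sum => x; apply: nonneg_unit. Qed.

Lemma content_perm s T : (forall x, brow (val (s x)) == brow (val x)) ->
  content_of (fperm s T) = content_of T.
Proof.
move=> srow; rewrite /content_of (reindex_inj (@perm_inj _ s)) /=.
by apply: eq_bigr => x _; rewrite /box_content ffunE permK (eqP (srow x)).
Qed.

(** Listing the pairs (row, entry) box by box, equal contents mean that
    the two lists agree up to a permutation of the boxes. *)
Lemma content_row_equiv T1 T2 : content_of T1 = content_of T2 -> row_equiv T1 T2.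
Proof.
move=> eqc; pose pr T x := (brow (val (x : D)), T x).
have cnt T (z : row_index * 'I_n) : (count_mem z [seq pr T x | x <- enum {: D}])%:R = content_of T z.
  case: z => r v; rewrite content_ofE count_map; congr (_%:R).
  rewrite [RHS]cardE [in RHS]/enum_mem size_filter -enumT.
  by apply: eq_count => x; rewrite !inE xpair_eqE.
have /tuple_permP[p ep] : perm_eq [seq pr T2 x | x <- enum {: D}]
    [tuple of [seq pr T1 x | x <- enum_tuple {: D}]].
  by apply/allP => z _ /=; rewrite -(eqr_nat int) !cnt eqc.
have s_inj : injective (fun x : D => enum_val (p (enum_rank x))).
  by move=> x y /enum_val_inj/perm_inj/enum_rank_inj.
pose s := perm s_inj.
have sE x : pr T2 x = pr T1 (s x).
  have := congr1 (nth (pr T2 x) ^~ (enum_rank x)) ep.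
  rewrite /= (nth_map x) -?cardE // nth_enum_rank => ->.
  rewrite (nth_map (enum_rank x)) ?size_enum_ord // nth_ord_enum.
  by rewrite tnth_map permE (tnth_nth x) /= (enum_val_nth x).
apply/existsP; exists (s^-1)%g; apply/andP; split.
  apply/forallP=> x; have := sE ((s^-1)%g x).
  by rewrite permKV => -[-> _].
apply/eqP/ffunP => x; rewrite ffunE invgK.
by have := sE x; rewrite /pr => -[].
Qed.

Section Exchange.

Variables (K : fieldType) (Q : lmodType K).
Variables (m0 : content n) (x : D) (r : row_index) (T : filling D n).
Hypotheses (m00 : nonneg m0) (m0r : forall v, m0 (r, v) = 0) (xr : brow (val x) != r).

Let A := x |: row_set D r.

(** The content of [T] after its entry in the box [x] has been moved to row [r]; the entries of
    [A], which are the ones that a permutation of [A] rearranges, are then all in row [r]. *)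
Definition merged_content : content n :=
  m0 + \sum_(z | z \notin A) box_content T z + \sum_(z in A) unit_content r (T z).

Lemma merged_contentE :
  merged_content = m0 + content_of T + unit_content r (T x)
                   - unit_content (brow (val x)) (T x).
Proof.
have xA : x \notin row_set D r by rewrite inE.
rewrite /content_of (bigID (mem A)) /= !(big_setU1 _ xA) /= /merged_content.
rewrite !(big_setU1 _ xA) /=.
have -> : \sum_(i in row_set D r) box_content T i
          = \sum_(i in row_set D r) unit_content r (T i).
  by apply: eq_bigr => i; rewrite inE /box_content => /eqP->.
rewrite {2}/box_content; set c := unit_content (brow _) _.
rewrite !addrA [RHS](ACl (1*4*5*3*(2*6))) /=.
by rewrite subrr addr0.
Qed.

Lemma nonneg_merged : nonneg merged_content.
Proof.
apply: nonnegD; first apply: nonnegD => //; apply: nonneg_sum => z; exact: nonneg_unit.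
Qed.

Lemma merged_row v :
  merged_content (r, v) = \sum_(z in A) (T z == v)%:R.
Proof.
rewrite /merged_content.
have -> : (m0 + \sum_(z | z \notin A) box_content T z
             + \sum_(z in A) unit_content r (T z)) (r, v)
  = m0 (r, v) + (\sum_(z | z \notin A) box_content T z) (r, v)
             + (\sum_(z in A) unit_content r (T z)) (r, v) by [].
rewrite m0r add0r !fct_sumE big1 ?add0r.
  by apply: eq_bigr => z _; rewrite /unit_content xpair_eqE eqxx eq_sym.
move=> z; rewrite !inE negb_or => /andP[_ zr].
by rewrite /box_content /unit_content xpair_eqE eq_sym (negPf zr).
Qed.

End Exchange.

Lemma merged_content_perm (m0 : content n) (x : D) r T (s : {perm D}) :
  perm_on (x |: row_set D r) s ->
  merged_content m0 x r (fperm s T) = merged_content m0 x r T.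
Proof.
move=> As; rewrite /merged_content; congr (_ + _ + _).
  apply: eq_bigr => z zA; rewrite /box_content ffunE; congr (unit_content _ (T _)).
  by apply: (@perm_inj _ s); rewrite permKV (out_perm As).
rewrite (reindex_inj (@perm_inj _ s)) /=; apply: eq_big => z.
  by rewrite (perm_closed _ As).
by rewrite ffunE permK.
Qed.

(** A permutation of row [r] and [x] returns one of the entries of the merged row to
    the row of [x]. Each entry is returned by equally many permutations, so that the
    symmetrizer is a multiple of the operator from row [r] to the row of [x]. *)
Lemma exchange_sum (K : fieldType) (Q : lmodType K) (f : content n -> Q) m0 (x : D) r T :
  nonneg m0 -> (forall v, m0 (r, v) = 0) -> brow (val x) != r ->
  gsum_map (fun S => f (m0 + content_of S)) (x |: row_set D r) T
  = polar r (brow (val x)) f (merged_content m0 x r T)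
    *+ #|[set s : {perm D} | perm_on (x |: row_set D r) s & s x == x]|.
Proof.
move=> m00 m0r xr; set A := _ |: _; set m := merged_content _ _ _ _.
pose phi z := f (m - unit_content r (T z) + unit_content (brow (val x)) (T z)).
have xA : x \in A by rewrite !inE eqxx.
have -> : polar r (brow (val x)) f m = \sum_(z in A) phi z.
  rewrite polarE; last exact: nonneg_merged.
  transitivity (\sum_v \sum_(z in A) (if T z == v then phi z else 0)).
    apply: eq_bigr => v _; rewrite {1}/m merged_row // rmorph_sum /= scaler_suml.
    apply: eq_bigr => z _; rewrite /phi; case: eqP => [->|_]; first by rewrite scale1r.
    by rewrite scale0r.
  rewrite exchange_big; apply: eq_bigr => z _.
  by rewrite -big_mkcond (big_pred1 (T z)) // => v; rewrite eq_sym.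
rewrite -sum_perm_preim //; apply: eq_bigr => s As; rewrite /phi; congr f.
rewrite /m -(merged_content_perm m0 T As) merged_contentE // ffunE.
by rewrite [RHS](ACl (1*2*(3*5)*(4*6))) /= subrr addNr !addr0.
Qed.

End Contents.

Section ClassFunction.

Variables (K : fieldType) (Q : lmodType K) (D : {fset box}) (n : nat) (y : row_index).
Variable (G : 'I_n -> filling D n -> Q).
Hypothesis char0 : [pchar K] =i pred0.
Implicit Types T : filling D n.
Hypothesis yD : forall x : D, brow (val x) != y.
Hypothesis G_row : forall v T1 T2, row_equiv T1 T2 -> G v T1 = G v T2.

Definition pair_content (p : 'I_n * filling D n) : content n :=
  unit_content y p.1 + content_of p.2.

(** A function of a basis vector and a filling that is constant on row equivalence
    classes, seen as a function of contents. The vector is recorded by an entry in the additional row [y]. *)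
Definition class_fun (m : content n) : Q :=
  if [pick p | `[< pair_content p = m >]] is Some p then G p.1 p.2 else 0.

Lemma content_y T v : content_of T (y, v) = 0 :> int.
Proof.
rewrite content_ofE (_ : [set x | _] = set0) ?cards0 //.
by apply/setP => x; rewrite !inE (negPf (yD x)).
Qed.

Lemma content_row_len T r : \sum_v content_of T (r, v) = (row_len D r)%:R :> int.
Proof.
rewrite /row_len -sum1_card natr_sum.
under [LHS]eq_bigr => v _ do rewrite content_ofE -sumr_const.
rewrite (exchange_big_dep (mem [set c : D | brow (val c) == r])) /=.
  apply: eq_bigr => x; rewrite inE => xr.
  by rewrite (big_pred1 (T x)) // => v; rewrite inE xr eq_sym.
by move=> v x _; rewrite !inE => /andP[].
Qed.

Lemma class_funE v T : class_fun (unit_content y v + content_of T) = G v T.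
Proof.
rewrite /class_fun; case: pickP => [[v' T'] /= /asboolP e|]; last first.
  by move/(_ (v, T)) => /asboolP.
have cy u U : pair_content (u, U) (y, v) = (v == u)%:R :> int.
  have -> : pair_content (u, U) (y, v)
            = unit_content y u (y, v) + content_of U (y, v) by [].
  by rewrite content_y addr0 /unit_content xpair_eqE eqxx.
have cvT := cy v T; rewrite eqxx in cvT.
have := cy v' T'; rewrite e.
rewrite [LHS](cvT : (unit_content y v + content_of T) (y, v) = 1).
case: eqP => // vv' _.
move: e; rewrite /pair_content /= -vv' => /addrI e.
exact/G_row/content_row_equiv.
Qed.

Lemma class_fun_out m : (forall p, pair_content p <> m) -> class_fun m = 0.
Proof. by move=> out; rewrite /class_fun; case: pickP => // p /asboolP /out. Qed.

Lemma class_fun_weight r : r != y ->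
  polar r r class_fun = (row_len D r)%:R *: class_fun.
Proof.
move=> ry; apply/funext => m; rewrite fctE.
have [[p pm]|out] := pselect (exists p, pair_content p = m); last first.
  have out' : class_fun m = 0 by apply: class_fun_out => p pm; apply: out; exists p.
  have [m0|m0] := pselect (nonneg m); last by rewrite polar_neg // out' scaler0.
  by rewrite polarE // big1 ?out' ?scaler0 // => v _; rewrite subrK out' scaler0.
have m0 : nonneg m.
  rewrite -pm; apply: nonnegD; [exact: nonneg_unit | exact: nonneg_content].
rewrite polarE //; under eq_bigr => v _ do rewrite subrK.
rewrite -scaler_suml -(rmorph_sum (intmul 1)); congr (_ *: _).
rewrite -[RHS]mulrz_nat -(content_row_len p.2) -pm; congr (_%:~R).
apply: eq_bigr => v _.
have -> : pair_content p (r, v) = unit_content y p.1 (r, v) + content_of p.2 (r, v) by [].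
by rewrite /unit_content xpair_eqE (negPf ry) add0r.
Qed.

(** If a content contributes, it arises from a filling [T] with a box [x] in row [c]
    by moving the entry of [x] to row [r]; then [exchange_sum] applies to [T]. *)
Lemma class_fun_exchange r c : r != c -> r != y -> c != y ->
  (forall v (x : D) T, brow (val x) = c -> gsum_map (G v) (x |: row_set D r) T = 0) ->
  polar r c class_fun = 0.
Proof.
move=> rc ry cy G0; apply/funext => m.
have [m0|m0] := pselect (nonneg m); last by rewrite polar_neg.
have [[v0 [p e]]|out] := pselect
    (exists v p, pair_content p = m - unit_content r v + unit_content c v); last first.
  rewrite polarE // big1 // => v _; rewrite class_fun_out ?scaler0 // => p e.
  by apply: out; exists v, p.
case: p e => u T e.
have eval (z : row_index * 'I_n) :
  (z == (y, u))%:R + content_of T z = m z - (z == (r, v0))%:R + (z == (c, v0))%:R.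
  exact: (congr1 (fun f => f z) e).
have : 0 < content_of T (c, v0).
  have := eval (c, v0); rewrite !xpair_eqE (negPf cy) [c == r]eq_sym (negPf rc) !eqxx /=.
  by rewrite add0r subr0 => ->; apply: ltr_wpDl => //; apply: m0.
rewrite content_ofE ltr0n => /card_gt0P[x]; rewrite inE => /andP[/eqP xc /eqP Tx].
have xr : brow (val x) != r by rewrite xc eq_sym.
have y0 v : unit_content y u (r, v) = 0 by rewrite /unit_content xpair_eqE (negPf ry).
have mE : m = merged_content (unit_content y u) x r T.
  rewrite merged_contentE // xc Tx -[_ + content_of T]/(pair_content (u, T)) e.
  by rewrite [RHS](ACl (1*(2*4)*(3*5))) /= addNr subrr !addr0.
have := exchange_sum class_fun T (@nonneg_unit _ y u) y0 xr.
rewrite xc -mE [LHS](_ : _ = 0); last first.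
  by rewrite -[RHS](G0 u x T xc); apply: eq_bigr => s _; exact: class_funE.
move/esym/(scale_nat_eq0 char0); apply.
by apply/card_gt0P; exists 1%g; rewrite inE perm_on1 perm1 eqxx.
Qed.

End ClassFunction.

(** Conversely to [class_fun_exchange], a function killed by the operators yields a map that
    kills the symmetrizers of [gsum_map_kill], hence all of them. *)
Lemma content_gsum_kill (K : fieldType) (Q : lmodType K) (D : {fset box}) n
    (rk : row_index -> nat) (g : content n -> Q) (A : {set D}) (T : filling D n) :
  [pchar K] =i pred0 ->
  (forall c d : D, rk (brow (val c)) = rk (brow (val d)) -> brow (val c) = brow (val d)) ->
  (forall c d : D, (rk (brow (val c)) <= rk (brow (val d)))%N ->
    (row_len D (brow (val c)) <= row_len D (brow (val d)))%N) ->
  (forall c d : D, (rk (brow (val c)) < rk (brow (val d)))%N ->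
     polar (brow (val d)) (brow (val c)) g = 0) ->
  (width A < #|A|)%N ->
  gsum_map (fun S => g (content_of S)) A T = 0.
Proof.
move=> char0 rk_inj rk_len g0 wA; apply: (gsum_map_kill char0 rk_inj) wA => //.
  by move=> s S srow; rewrite content_perm.
move=> d x S xd.
have xr : brow (val x) != brow (val d).
  by apply: contraTneq xd => ->; rewrite ltnn.
have := exchange_sum g (m0 := 0) S _ _ xr; rewrite g0 //= mul0rn => <- //.
by apply: eq_bigr => s _; rewrite add0r.
Qed.

(** * Rows of evacuation routes *)

Section Routes.

Variables (N : nat) (h : nat -> nat).

Definition row_lt (p q : row_index) : bool :=
  (p.1 < q.1)%N || (p.1 == q.1) && (p.2 < q.2)%N.

Lemma row_lt_trans : transitive row_lt.
Proof. by move=> [q1 q2] [p1 p2] [r1 r2]; rewrite /row_lt /=; lia. Qed.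

Lemma row_lt_irr : irreflexive row_lt.
Proof. by move=> [p1 p2]; rewrite /row_lt /=; lia. Qed.

Definition block_rows (b k : nat) : seq row_index := [seq (b, i) | i <- iota 1 k].

(** The sequences of rows, from bottom to top, that an evacuation route can meet in the [t]
    blocks starting at [b]; the recursion is that of [sweep]. *)
Fixpoint routes (t b : nat) : seq (seq row_index) :=
  if t is t'.+1 then
    routes t' b.+1
    ++ [seq block_rows b k ++ s | k <- iota 1 (h b), s <- routes t' b.+1]
  else [:: [::]].

Definition head_routes (t b : nat) : seq (seq row_index) :=
  [seq block_rows b k ++ s | k <- iota 1 (h b), s <- routes t b.+1].

Definition is_route (b : nat) (s : seq row_index) : Prop :=
  [/\ sorted row_lt s, {in s, forall r, valid_row N h r && (b <= r.1)%N}
    & {in s, forall r k, (0 < k < r.2)%N -> (r.1, k) \in s}].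

Lemma mem_block_rows b k r : (r \in block_rows b k) = (r.1 == b) && (0 < r.2 <= k)%N.
Proof.
case: r => r1 r2; apply/mapP/andP => [[i + [-> ->]]|[/= /eqP -> ik]].
  by rewrite mem_iota /= add1n ltnS eqxx.
by exists r2; rewrite // mem_iota add1n ltnS.
Qed.

Lemma sorted_block_rows b k : sorted row_lt (block_rows b k).
Proof.
rewrite sorted_map (@sub_sorted _ ltn) ?iota_ltn_sorted // => i j ij.
by rewrite /row_lt /= eqxx; apply/orP; right.
Qed.

Lemma is_route_head b s : is_route b s -> (b, 1%N) \in s -> s = (b, 1%N) :: behead s.
Proof.
case: s => // r s [/= rs vs _]; rewrite inE => /orP[/eqP <- //|bs].
have := order_path_min row_lt_trans rs => /allP/(_ _ bs).
have := vs r; rewrite inE eqxx => /(_ isT).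
by case: r {rs vs} => r1 r2; rewrite /valid_row /row_lt /=; lia.
Qed.

Lemma is_route_cat b k s : (0 < b <= N)%N -> (k <= h b)%N ->
  is_route b.+1 s -> is_route b (block_rows b k ++ s).
Proof.
move=> bN kh [ss vs cs]; split.
- rewrite sorted_pairwise; last exact: row_lt_trans.
  rewrite pairwise_cat -!sorted_pairwise ?sorted_block_rows ?ss ?andbT;
    try exact: row_lt_trans.
  apply/allrelP => p q; rewrite mem_block_rows => /andP[/eqP pb _] /vs/andP[_ bq].
  by rewrite /row_lt pb bq.
- move=> r; rewrite mem_cat mem_block_rows => /orP[/andP[/eqP rb rk]|/vs/andP[-> /ltnW //]].
  by case/andP: rk => r0 rk; rewrite /valid_row rb bN r0 leqnn (leq_trans rk kh).
move=> r; rewrite mem_cat => /orP[rb|rs] k' kr; rewrite mem_cat; last by rewrite (cs r) ?orbT.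
move: rb; rewrite !mem_block_rows => /andP[-> /andP[_ rk]] /=.
by case/andP: kr => -> /ltnW kr; rewrite (leq_trans kr rk).
Qed.

Lemma is_routeW b s : is_route b.+1 s -> is_route b s.
Proof. by case=> ss vs cs; split=> // r /vs/andP[-> /ltnW]. Qed.

Lemma is_route_split b s : (0 < b <= N)%N -> is_route b s ->
  exists k s', [/\ (k <= h b)%N, is_route b.+1 s' & s = block_rows b k ++ s'].
Proof.
move=> bN [ss vs cs].
(* The rows of block b in s are the k lowest ones, with k maximal. *)
pose Pk k := (k == 0)%N || ((b, k) \in s).
have exP : exists k, Pk k by exists 0%N.
have bdP k : Pk k -> (k <= h b)%N.
  by case/orP=> [/eqP-> //|/vs]; rewrite /valid_row /=; lia.
case: (ex_maxnP exP bdP) => k Pkk kmax.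
have in_s : forall i, ((b, i) \in s) = (0 < i <= k)%N.
  move=> i; apply/idP/idP => [ins|ik].
    by rewrite kmax ?/Pk ?ins ?orbT // andbT; have := vs _ ins; rewrite /valid_row /=; lia.
  have [->|ik'] := eqVneq i k; first by case/orP: Pkk => // /eqP e; lia.
  case/orP: Pkk => [/eqP e|/cs ck]; first lia.
  by apply: ck => /=; lia.
pose s' := [seq r <- s | (b < r.1)%N].
have s'_route : is_route b.+1 s'.
  split=> [|r|r].
  - exact: sorted_filter row_lt_trans _ _ ss.
  - by rewrite mem_filter => /andP[br /vs/andP[->]].
  by rewrite mem_filter => /andP[br rs] i ir; rewrite mem_filter /= br (cs r).
exists k, s'; split=> //; first exact: bdP.
apply: (irr_sorted_eq row_lt_trans row_lt_irr) => //.
  by case: (@is_route_cat b k s') => //; apply: bdP.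
move=> [r1 r2]; rewrite mem_cat mem_block_rows mem_filter /=.
have [rb|rb|->] := ltngtP r1 b; rewrite ?orbF ?in_s //=.
by apply/negP => /vs/andP[_ /=]; lia.
Qed.

Lemma routesP t b s : (t + b = N.+1)%N -> (0 < b)%N ->
  reflect (is_route b s) (s \in routes t b).
Proof.
elim: t b s => [|t IHt] b s tb b0.
  rewrite inE; apply: (iffP eqP) => [-> //|[_ vs _]]; case: s vs => // r s vs.
  by have := vs r; rewrite inE eqxx /valid_row => /(_ isT); lia.
have IH s' := IHt b.+1 s' _ _.
have bN : (0 < b <= N)%N by lia.
rewrite /= mem_cat; apply: (iffP orP) => [[|]|].
- by move/(IHt b.+1) => H; apply: is_routeW; apply: H; lia.
- case/allpairsP=> -[k s'] [/=]; rewrite mem_iota => kh /IHt s'r ->.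
  by apply: is_route_cat => //; [lia | apply: s'r; lia].
case/is_route_split=> // k [s' [kh s'r ->]].
case: k kh => [|k] kh; first by left; apply/IHt => //; lia.
right; apply/allpairsP; exists (k.+1, s'); split=> //=; first by rewrite mem_iota; lia.
by apply/IHt => //; lia.
Qed.

Lemma head_routesP t b s : (t + b = N)%N -> (0 < b)%N ->
  reflect (is_route b s /\ (b, 1%N) \in s) (s \in head_routes t b).
Proof.
move=> tb b0; have bN : (0 < b <= N)%N by lia.
apply: (iffP allpairsP) => [[[k s'] /= [+ + ->]]|[/is_route_split]].
  rewrite mem_iota => kh /routesP s'r; split; last by rewrite mem_cat mem_block_rows /=; lia.
  by apply: is_route_cat => //; [lia | apply: s'r; lia].
case/(_ bN) => k [s' [kh s'r ->]] bs; exists (k, s'); split=> //=.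
  rewrite mem_iota; move: bs; rewrite mem_cat mem_block_rows /=.
  by case: s'r => _ vs' _ /orP[|/vs']/=; lia.
by apply/routesP => //; lia.
Qed.

Lemma uniq_block_cat t b : (t + b = N)%N -> uniq (routes t b.+1) -> uniq (head_routes t b).
Proof.
move=> tb uR; apply: allpairs_uniq; rewrite ?iota_uniq //.
have rP s : s \in routes t b.+1 -> is_route b.+1 s.
  by move/routesP; apply; lia.
(* The rows in block b determine k, and the remaining ones s. *)
have split_low k s : is_route b.+1 s ->
    [seq r <- block_rows b k ++ s | r.1 == b] = block_rows b k.
  case=> _ vs _; rewrite filter_cat -[RHS]cats0; congr (_ ++ _).
    by apply/all_filterP/allP => r; rewrite mem_block_rows => /andP[].
  rewrite -(filter_pred0 s); apply: eq_in_filter => r /vs/andP[_].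
  by rewrite ltn_neqAle eq_sym => /andP[/negPf].
move=> _ _ /allpairsP[[k s] /= [_ /rP sr ->]] /allpairsP[[k' s'] /= [_ /rP sr' ->]] e.
have ek : k = k'.
  have := congr1 (fun u => size [seq r <- u | r.1 == b]) e.
  by rewrite !split_low // !size_map !size_iota.
by move: e; rewrite ek => /eqP; rewrite eqseq_cat // eqxx => /= /eqP->.
Qed.

Lemma uniq_routes t b : (t + b = N.+1)%N -> (0 < b)%N -> uniq (routes t b).
Proof.
elim: t b => //= t IHt b tb b0; have uR : uniq (routes t b.+1) by apply: IHt; lia.
rewrite cat_uniq uR -/(head_routes t b) uniq_block_cat ?andbT; last 2 first.
- lia.
- done.
apply/hasPn=> s /head_routesP[|//|_ bs]; first lia.
apply/negP=> /routesP []; try lia.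
by move=> _ /(_ _ bs)/andP[_ /=]; rewrite ltnn.
Qed.

Section Expansion.

Variables (K : fieldType) (U : lmodType K) (D : row_index -> row_index -> {linear U -> U}).
Variable c : nat -> K.

Fixpoint steps (f : U) (a : row_index) (s : seq row_index) : U :=
  if s is r :: s' then steps (D a r f) r s' else f.

Definition walk (f : U) (a : row_index) (s : seq row_index) : U := steps f a (rcons s (N.+1, 1%N)).

Definition route_coef (b : nat) (s : seq row_index) : K :=
  (-1) ^+ size s * \prod_(b <= j < N.+1) (if has (fun r : row_index => r.1 == j) s then c j else 1).

Lemma steps_cat f a s s' : steps f a (s ++ s') = steps (steps f a s) (last a s) s'.
Proof. by elim: s f a => //= r s IHs f a. Qed.

Lemma block_rowsS b k : block_rows b k.+1 = rcons (block_rows b k) (b, k.+1).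
Proof. by rewrite /block_rows -[k.+1]addn1 iotaD map_cat /= add1n addn1 cats1. Qed.

Lemma steps_block f a b k :
  steps f a (block_rows b k.+1) = climb D b k (D a (b, 1%N) f).
Proof.
elim: k => [//|k IHk].
by rewrite block_rowsS -cats1 steps_cat IHk block_rowsS last_rcons.
Qed.

Lemma walk_block f a b k s :
  walk f a (block_rows b k.+1 ++ s)
  = walk (climb D b k (D a (b, 1%N) f)) (b, k.+1) s.
Proof. by rewrite /walk rcons_cat steps_cat steps_block block_rowsS last_rcons. Qed.

Lemma walk_head_block f b k s :
  walk f (b, 1%N) (behead (block_rows b k.+1 ++ s))
  = walk (climb D b k f) (b, k.+1) s.
Proof.
have stepsB : steps f (b, 1%N) (behead (block_rows b k.+1)) = climb D b k f.
  elim: k => [//|k IHk].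
  have -> : behead (block_rows b k.+2) = rcons (behead (block_rows b k.+1)) (b, k.+2).
    by rewrite block_rowsS.
  rewrite -cats1 steps_cat IHk /=; congr (D _ _ _).
  by rewrite -[RHS](last_rcons (b, 1%N) (block_rows b k)) -block_rowsS.
rewrite (_ : behead _ = behead (block_rows b k.+1) ++ s) // /walk rcons_cat steps_cat.
rewrite stepsB; congr (steps _ _ _).
by rewrite -[RHS](last_rcons (b, 1%N) (block_rows b k)) -block_rowsS.
Qed.

Lemma coef_block b k s : (0 < b <= N)%N -> is_route b.+1 s ->
  route_coef b (block_rows b k.+1 ++ s) = (-1) ^+ k.+1 * c b * route_coef b.+1 s.
Proof.
move=> bN [_ vs _]; rewrite /route_coef size_cat size_map size_iota exprD.
rewrite big_ltn; last lia.
rewrite [X in if X then _ else _](_ : _ = true); last by rewrite has_cat /= eqxx.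
rewrite -!mulrA; congr (_ * _); rewrite mulrCA; congr (_ * (_ * _)).
apply: eq_big_nat => j bj; rewrite has_cat [X in X || _](_ : _ = false) //.
by apply/hasPn => -[r1 r2]; rewrite mem_block_rows /=; lia.
Qed.

Lemma coef_skip b s : (0 < b <= N)%N -> is_route b.+1 s ->
  route_coef b s = route_coef b.+1 s.
Proof.
move=> bN [_ vs _]; rewrite /route_coef big_ltn; last lia.
have -> : has (fun r : row_index => r.1 == b) s = false.
  by apply/hasPn => -[r1 r2] /vs /=; lia.
by rewrite mul1r.
Qed.

Lemma sum_iota1 m (F : nat -> U) : \sum_(k <- iota 1 m) F k = \sum_(k < m) F k.+1.
Proof.
have -> : iota 1 m = index_iota 1 m.+1 by rewrite /index_iota subn1.
by rewrite big_add1 big_mkord.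
Qed.

Lemma sweep_routes t b f a : (t + b = N.+1)%N -> (0 < b)%N ->
  sweep D h c t b f a = \sum_(s <- routes t b) route_coef b s *: walk f a s.
Proof.
elim: t b f a => [|t IHt] b f a tb b0.
  rewrite add0n in tb; subst b.
  by rewrite /= big_seq1 /route_coef big_geq // mulr1 scale1r.
have bN : (0 < b <= N)%N by lia.
have rP s : s \in routes t b.+1 -> is_route b.+1 s by move/routesP; apply; lia.
rewrite /= big_cat IHt //=; last lia.
congr (_ + _).
  by apply: eq_big_seq => s /rP sr; rewrite (coef_skip bN sr).
rewrite big_allpairs_dep scaler_sumr sum_iota1; apply: eq_bigr => k _.
rewrite IHt //; last lia.
rewrite scalerA scaler_sumr; apply: eq_big_seq => s /rP sr.
by rewrite coef_block // walk_block scalerA [c b * _]mulrC.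
Qed.

Lemma block_sum_routes t b f : (t + b = N)%N -> (0 < b)%N -> 
  block_sum D h c t b f
  = \sum_(s <- head_routes t b) route_coef b.+1 s *: walk f (b, 1%N) (behead s).
Proof.
move=> tb b0.
have bN : (0 < b <= N)%N by lia.
have rP s : s \in routes t b.+1 -> is_route b.+1 s by move/routesP; apply; lia.
rewrite big_allpairs_dep sum_iota1; apply: eq_bigr => k _.
rewrite sweep_routes; try lia.
rewrite scaler_sumr; apply: eq_big_seq => s /rP [_ vs _].
rewrite scalerA; congr (_ *: _).
  rewrite /route_coef size_cat size_map size_iota exprD -mulrA; congr (_ * (_ * _)).
  apply: eq_big_nat => j bj; rewrite has_cat [X in X || _](_ : _ = false) //.
  by apply/hasPn => -[r1 r2]; rewrite mem_block_rows /=; lia.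
by rewrite walk_head_block.
Qed.

End Expansion.
End Routes.

(** * Choosing one box in each row *)

Section Picks.

Variable D : {fset box}.

Fixpoint picks (s : seq row_index) : seq (seq D) :=
  if s is r :: s' then [seq x :: c | x <- enum (row_set D r), c <- picks s'] else [:: [::]].

Definition rows_of (c : seq D) : seq row_index := [seq brow (val x) | x <- c].

Lemma mem_picks s c : (c \in picks s) = (rows_of c == s).
Proof.
elim: s c => [|r s IHs] c /=; first by rewrite inE; case: c.
apply/allpairsP/idP => [[[x c'] /= [+ + ->]]|].
  by rewrite mem_enum inE IHs => /eqP <- /eqP <- /=.
case: c => [|x c] //=; rewrite eqseq_cons => /andP[xr cs]; exists (x, c).
by rewrite /= mem_enum inE xr IHs cs.
Qed.

Lemma uniq_picks s : uniq (picks s).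
Proof.
elim: s => //= r s IHs; apply: allpairs_uniq; rewrite ?enum_uniq //.
by move=> [x c] [x' c'] _ _ /= [-> ->].
Qed.

Lemma big_picks (V : nmodType) (F : seq D -> V) r s :
  \sum_(c <- picks (r :: s)) F c
  = \sum_(x in row_set D r) \sum_(c <- picks s) F (x :: c).
Proof. by rewrite big_allpairs_dep big_enum. Qed.

Section Evaluation.

Variables (K : fieldType) (Q : lmodType K) (n : nat) (y : row_index).
Variable T : filling D n.
Hypothesis yD : forall x : D, brow (val x) != y.
Local Notation U := (content n -> Q).
Local Notation P := (fun a b => polar a b : {linear U -> U}).

(** The change of content when the entry of each box of [c] moves to the row of the
    next box, and the last one to row [y]. *)
Fixpoint shift (c : seq D) : content n :=
  if c is x :: c' then
    unit_content (head y (rows_of c')) (T x) - unit_content (brow (val x)) (T x) + shift c'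
  else 0.

Definition agree (m : content n) (r : row_index) : Prop :=
  forall v, m (r, v) = content_of T (r, v).

Lemma polar_agree a b (f : U) m : nonneg m -> agree m a ->
  polar a b f m = \sum_(x in row_set D a)
    f (m - unit_content a (T x) + unit_content b (T x)).
Proof.
move=> m0 ma; rewrite polarE //.
under eq_bigr => v _ do rewrite ma content_ofE.
rewrite [RHS](partition_big T xpredT) //=; apply: eq_bigr => v _.
rewrite (eq_bigr (fun=> f (m - unit_content a v + unit_content b v))).
  rewrite sumr_const mulrz_nat scaler_nat; congr (_ *+ _).
  by apply: eq_card => x; rewrite [in RHS]unfold_in !inE.
by move=> x /andP[_ /eqP->].
Qed.

Lemma shift_rows c r v : r != y -> r \notin rows_of c -> shift c (r, v) = 0.
Proof.
move=> ry; elim: c => //= x c IHc; rewrite inE negb_or => /andP[rx rc].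
have -> : (unit_content (head y (rows_of c)) (T x) - unit_content (brow (val x)) (T x)
    + shift c) (r, v) = ((r, v) == (head y (rows_of c), T x))%:R
    - ((r, v) == (brow (val x), T x))%:R + shift c (r, v) by [].
rewrite IHc // !xpair_eqE (negPf rx) subr0 addr0.
case: c rc {IHc} => [|z c] /=; first by rewrite (negPf ry).
by rewrite inE negb_or => /andP[/negPf-> _].
Qed.

Lemma shift_ge c z : - (\sum_(x <- c) box_content T x z) <= shift c z.
Proof.
elim: c => [|x c IHc] /=; first by rewrite big_nil oppr0.
rewrite big_cons opprD; apply: lerD IHc.
have -> : (unit_content (head y (rows_of c)) (T x) - unit_content (brow (val x)) (T x)) z
  = unit_content (head y (rows_of c)) (T x) z - unit_content (brow (val x)) (T x) z by [].
by rewrite lerDr; apply: nonneg_unit.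
Qed.

(** The rows being distinct, at most one entry is removed from each row, and this is an entry
    that [T] has there. *)
Lemma nonneg_shift c m : nonneg m -> uniq (rows_of c) ->
  (forall r, r \in rows_of c -> agree m r) -> nonneg (m + shift c).
Proof.
move=> m0 uc mc [r v].
have -> : (m + shift c) (r, v) = m (r, v) + shift c (r, v) by [].
have := shift_ge c (r, v); rewrite -subr_ge0 opprK => /le_trans; apply.
rewrite addrC lerD2r; have [rc|rc] := boolP (r \in rows_of c); last first.
  rewrite big_seq big1 // => x xc; rewrite /box_content /unit_content xpair_eqE.
  by case: eqP => // e; case/negP: rc; rewrite e; apply: map_f.
rewrite mc // /content_of fct_sumE big_uniq ?(map_uniq uc) //=.
by rewrite big_mkcond /=; apply: ler_sum => x _; case: ifP.
Qed.

(** By induction on the number of rows: the first operator of the chain acts last on contents,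
    when the later rows have already received and lost an entry, but row [a] has not been
    changed yet. *)
Lemma steps_picks (f : U) a s m : uniq (a :: s) -> y \notin a :: s -> nonneg m ->
  (forall r, r \in a :: s -> agree m r) ->
  steps P f a (rcons s y) m = \sum_(c <- picks (a :: s)) f (m + shift c).
Proof.
elim: s f a m => [|r s IHs] f a m uas yas m0 ma.
  rewrite -[steps _ _ _ _]/(polar a y f) polar_agree ?mem_head ?(big_picks (fun c => f (m + shift c))) //; last exact/ma/mem_head.
  apply: eq_bigr => x; rewrite inE big_seq1 /= => /eqP->; congr f.
  by rewrite addr0 addrA addrAC.
rewrite -[steps _ _ _ _]/(steps P (polar a r f) r (rcons s y)) IHs //; last 3 first.
- by case/andP: uas.
- by move: yas; rewrite inE negb_or => /andP[].
- by move=> r' r's; apply: ma; rewrite inE r's orbT.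
rewrite (big_picks (fun c => f (m + shift c))) exchange_big.
apply: eq_big_seq => c; rewrite mem_picks => /eqP cs.
have ac : a \notin rows_of c by rewrite cs; case/andP: uas.
have ay : a != y by move: yas; rewrite inE negb_or eq_sym => /andP[].
rewrite polar_agree.
- apply: eq_bigr => x; rewrite inE => /eqP xa; congr f.
  by rewrite /= cs /= xa !addrA [RHS](ACl (1*4*3*2)).
- apply: nonneg_shift => //; first by rewrite cs; case/andP: uas.
  by move=> r' r'c; apply: ma; rewrite inE -cs r'c orbT.
move=> v; rewrite -(ma a (mem_head _ _)).
have -> : (m + shift c) (a, v) = m (a, v) + shift c (a, v) by [].
by rewrite shift_rows ?addr0.
Qed.

End Evaluation.
End Picks.

(** * 1-paths as chains of boxes *)

Section Paths.

Variables (N : nat) (w h : nat -> nat) (b1 : nat).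
Hypotheses (x1_lam : box_x1 w b1 \in diagram N w h) (b1_ok : (0 < b1 <= N)%N).

Local Notation lam := (diagram N w h).
Local Notation E := (ediagram N w h).
Local Notation y := (N.+1, 1%N).

Definition inE_lam (d : lam) : E := fincl (fsubsetU1 _ _) d.
Local Notation io := inE_lam.

Lemma y1_E : box_y1 N \in E. Proof. exact: fset1U1. Qed.
Definition y1E : E := [` y1_E].
Definition x1D : lam := [` x1_lam].
Local Notation x1E := (io x1D).

Lemma io_inj : injective io.
Proof. by move=> d d' /(congr1 val) /= e; apply: val_inj. Qed.

Lemma lam_valid (d : lam) : valid_row N h (brow (val d)).
Proof.
by case: d => [[[b i] j]] /=; rewrite mem_diagram /valid_row => /and3P[-> -> _].
Qed.

Lemma lam_y (d : lam) : brow (val d) != y.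
Proof.
by apply/eqP=> e; have := lam_valid d; rewrite e /valid_row /= ltnn.
Qed.

Lemma io_y1 d : io d != y1E.
Proof.
by apply/eqP=> /(congr1 (fun z : E => brow (val z))) /= /eqP; apply/negP/lam_y.
Qed.

Lemma E_case (z : E) : z = y1E \/ exists d, z = io d.
Proof.
have := valP z; rewrite in_fset1U => /orP[/eqP zy|zl].
  by left; apply: val_inj.
by right; exists [` zl]; apply: val_inj.
Qed.

Lemma seq_preim (s : seq E) : y1E \notin s -> exists c, s = map io c.
Proof.
elim: s => [|z s IHs] ; first by exists [::].
rewrite inE negb_or eq_sym => /andP[zy /IHs[c ->]].
by case: (E_case z) zy => [->|[d -> _]]; [rewrite eqxx | exists (d :: c)].
Qed.

Lemma set_XE : set_X N w h b1 = [set x1E].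
Proof. by apply/setP => z; rewrite !inE -val_eqE. Qed.

Lemma set_YE : set_Y N w h = [set y1E].
Proof. by apply/setP => z; rewrite !inE -val_eqE. Qed.

Definition is_chain (c : seq lam) : Prop :=
  is_route N h b1 (rows_of c) /\ (b1, 1%N) \in rows_of c.

(** The orbit of a 1-path starts at x_1 whether or not the evacuation route contains x_1; this is
    the part of the route that comes after x_1. *)
Definition chain_tail (c : seq lam) : seq lam := if x1D \in c then behead c else c.

Definition chain_orbit (c : seq lam) : seq E :=
  x1E :: rcons (map io (chain_tail c)) y1E.

Definition chain_map (c : seq lam) : {ffun E -> E} :=
  [ffun z => if z \in chain_orbit c
             then nth y1E (chain_orbit c) (index z (chain_orbit c)).+1 else z].

Definition chain_path (c : seq lam) : {ffun E -> E} * {set E} :=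
  (chain_map c, [set z in map io c]).

Lemma row_lt_box (p q : box) : box_lt p q = row_lt (brow p) (brow q).
Proof. by []. Qed.

Section Chain.

Variable c : seq lam.
Hypothesis c_chain : is_chain c.

Let rows_uniq : uniq (rows_of c).
Proof.
case: c_chain => [[cs _ _] _].
exact: (sorted_uniq row_lt_trans row_lt_irr).
Qed.

Lemma chain_head : exists x0 c', c = x0 :: c' /\ brow (val x0) = (b1, 1%N).
Proof.
case: c_chain => /is_route_head/[apply]; case: (c) => [|x0 c'] //= [e].
by exists x0, c'.
Qed.

Lemma chain_x1 : x1D \in c -> c = x1D :: behead c.
Proof.
have [x0 [c' [ec ex]]] := chain_head.
rewrite ec inE => /orP[/eqP->|x1c] //=.
move: rows_uniq; rewrite ec /= ex => /andP[/negP[]].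
by rewrite -[(b1, 1%N)]/(brow (val x1D)); apply: map_f.
Qed.

Lemma chain_tail_x1 : x1D \notin chain_tail c.
Proof.
rewrite /chain_tail; case: ifP => [/chain_x1 e|/negbT //].
have := map_uniq rows_uniq; rewrite {1}e /= => /andP[].
by [].
Qed.


Lemma chain_orbit_mem z : (z \in chain_orbit c) = [|| z == x1E, z \in map io c | z == y1E].
Proof.
rewrite inE mem_rcons inE /chain_tail; case: ifP => [/chain_x1 e|_].
  by rewrite {2}e /= inE; case: eqP; rewrite //= orbC.
by case: eqP => //= _; rewrite orbC.
Qed.

Lemma chain_tail_uniq : uniq (chain_tail c).
Proof.
have := map_uniq rows_uniq; rewrite /chain_tail; case: ifP => // _.
by case: (c) => // x c' /andP[].
Qed.

Lemma chain_orbit_uniq : uniq (chain_orbit c).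
Proof.
rewrite /= mem_rcons inE negb_or io_y1 (mem_map io_inj) chain_tail_x1.
rewrite rcons_uniq (map_inj_uniq io_inj) chain_tail_uniq !andbT.
by apply/mapP=> -[d _ e]; have := io_y1 d; rewrite -e eqxx.
Qed.

Lemma chain_map_path : path (frel (chain_map c)) x1E (rcons (map io (chain_tail c)) y1E).
Proof.
apply/(pathP y1E) => i ip; rewrite -/(chain_orbit c) /= ffunE.
have iL : (i < size (chain_orbit c))%N by rewrite /= ltnS ltnW.
by rewrite mem_nth // index_uniq // chain_orbit_uniq.
Qed.

Lemma chain_map_y1 : chain_map c y1E = y1E.
Proof.
rewrite ffunE; case: ifP => // _; rewrite nth_default //.
have := chain_orbit_uniq; rewrite /chain_orbit.
rewrite -{3}[y1E](last_rcons x1E (map io (chain_tail c)) y1E) => u.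
by rewrite index_last.
Qed.

Lemma chain_map_id z : z \notin x1E :: map io c -> chain_map c z = z.
Proof.
have [->|zy zc] := eqVneq z y1E; first by rewrite chain_map_y1.
by rewrite ffunE chain_orbit_mem orbA -in_cons (negPf zc) (negPf zy).
Qed.

Lemma chain_map_sorted : sorted (frel (chain_map c)) (rcons (map io c) y1E).
Proof.
have := chain_map_path; rewrite /chain_tail; case: ifP => [/chain_x1 e|_].
  by have -> : map io c = x1E :: map io (behead c) by rewrite {1}e.
by move/path_sorted.
Qed.

Lemma chain_rows_sorted :
  sorted row_lt (rcons (rows_of c) y).
Proof.
case: c_chain => [[cs vs _] _]; rewrite -cats1 sorted_pairwise; last exact: row_lt_trans.
rewrite pairwise_cat -!sorted_pairwise ?cs; try exact: row_lt_trans.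
rewrite /= !andbT; apply/allrelP => p q /vs/andP[]; rewrite inE /valid_row => pv _ /eqP->.
by move: pv; case: p => p1 p2; rewrite /row_lt /=; lia.
Qed.

Let s' := rcons (map io c) y1E.

Let size_s' : size s' = (size c).+1. Proof. by rewrite size_rcons size_map. Qed.

Lemma chain_nth_map i : (i < size c)%N ->
  chain_map c (nth y1E s' i) = nth y1E s' i.+1.
Proof.
move=> ic; apply/eqP; have /sortedP := chain_map_sorted; move/(_ y1E i).
by rewrite size_s' ltnS => /(_ ic).
Qed.

Lemma chain_nth_lt i j : (i < j <= size c)%N ->
  row_lt (brow (val (nth y1E s' i))) (brow (val (nth y1E s' j))).
Proof.
move=> /andP[ij jc].
have es : map (fun z : E => brow (val z)) s' = rcons (rows_of c) y.
  by rewrite map_rcons -map_comp.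
have := chain_rows_sorted; rewrite -es => /(sorted_ltn_nth row_lt_trans y).
move/(_ i j); rewrite !inE size_map size_s' => /(_ _ _ ij).
rewrite !(nth_map y1E) ?size_s' ?ltnS //; last exact: ltnW (leq_trans ij jc).
by apply=> //; exact: ltnW (leq_trans ij jc).
Qed.

Lemma chain_nthP z : z \in map io c -> exists2 i, (i < size c)%N & z = nth y1E s' i.
Proof.
move=> zc; exists (index z (map io c)); first by rewrite -(size_map io) index_mem.
by rewrite nth_rcons index_mem zc nth_index.
Qed.

Lemma chain_map_lt z : z \in map io c -> row_lt (brow (val z)) (brow (val (chain_map c z))).
Proof. by case/chain_nthP => i ic ->; rewrite chain_nth_map // chain_nth_lt // ltnSn. Qed.

(** The successor of [z] is weakly below [z'], hence strictly below its successor. *)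
Lemma chain_map_mono z z' : z \in map io c -> z' \in map io c ->
  row_lt (brow (val z)) (brow (val z')) ->
  row_lt (brow (val (chain_map c z))) (brow (val (chain_map c z'))).
Proof.
case/chain_nthP => i ic ->; case/chain_nthP => j jc ->.
have [ij _|ji|->] := ltngtP i j; last by rewrite row_lt_irr.
  by rewrite !chain_nth_map // chain_nth_lt // ltnS ij.
have lt := @chain_nth_lt j i; rewrite ji (ltnW ic) in lt.
by move=> /row_lt_trans/(_ (lt isT)); rewrite row_lt_irr.
Qed.

Lemma chain_map_x1 : x1D \notin c -> brow (val (chain_map c x1E)) = (b1, 1%N).
Proof.
move=> x1c; have [x0 [c' [ec ex]]] := chain_head.
have em : map io c = io x0 :: map io c' by rewrite ec.
by have := chain_map_path; rewrite /chain_tail (negPf x1c) em => /= /andP[/eqP-> _].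
Qed.

Lemma chain_connect z : fconnect (chain_map c) x1E z = (z \in chain_orbit c).
Proof.
apply/idP/idP => [/iter_findex <-|].
  elim: (findex _ _ _) => [|k IHk] /=; first exact: mem_head.
  rewrite [chain_map c _]ffunE IHk; set o := chain_orbit c; set i := index _ _.
  have [io'|io'] := ltnP i.+1 (size o); first exact: mem_nth.
  by rewrite nth_default // /o /chain_orbit inE mem_rcons mem_head orbT.
have /fpathP[k ek] := chain_map_path.
rewrite /chain_orbit ek -trajectS => /trajectP[i _ ->]; exact: fconnect_iter.
Qed.

Lemma path_frel_map (T : eqType) (P : T -> T) a s l :
  path (frel P) a (rcons s l) -> map P (a :: s) = rcons s l.
Proof. by elim: s a => [|b s IHs] a /= /andP[/eqP-> // pb]; rewrite -(IHs b). Qed.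

Lemma chain_tail_mem z :
  (z \in x1E :: map io (chain_tail c)) = (z \in x1E :: map io c).
Proof.
rewrite /chain_tail; case: ifP => // /chain_x1 e.
by rewrite [in RHS]e /= !inE orbA orbb.
Qed.

Lemma chain_path_one_path : one_path b1 (chain_path c).
Proof.
have inR z : (z \in [set z in map io c]) = (z \in map io c) by rewrite inE.
have RX z : (z \in [set z in map io c] :|: set_X N w h b1) = (z \in x1E :: map io c).
  by rewrite in_setU inR set_XE !inE orbC.
have [[cs vs cl] b1c] := c_chain.
rewrite /one_path /chain_path; apply/and5P; split; last (apply/and4P; split).
- apply/and4P; split.
  + apply/subsetP=> z; rewrite inR !in_setC set_YE inE => /mapP[d _ ->]; exact: io_y1.
  + have /mapP[d dc ed] := b1c; apply/existsP; exists (io d).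
    by rewrite inR map_f //= -ed.
  + apply/forall_inP=> z; rewrite inR => /mapP[d dc ->].
    apply/forall_inP=> z'; rewrite inR => /mapP[d' dc' ->]; apply/implyP => /eqP e.
    apply/eqP; move/chain_nthP: (map_f io dc) e => [i ic ->].
    move/chain_nthP: (map_f io dc') => [j jc ->].
    have [ij|ji|->//] := ltngtP i j.
      by have := @chain_nth_lt i j; rewrite ij ltnW // => /(_ isT) lt e; rewrite e row_lt_irr in lt.
    by have := @chain_nth_lt j i; rewrite ji ltnW // => /(_ isT) lt e; rewrite e row_lt_irr in lt.
  + apply/forall_inP=> z; rewrite inR => /mapP[d dc ->]; apply/forallP => k.
    apply/implyP => k0.
    have := cl (brow (val d)) (map_f _ dc) k; rewrite k0 (ltn_ord k) => /(_ isT).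
    case/mapP=> d' dc' e; apply/existsP; exists (io d'); rewrite inR map_f //=.
    by apply/eqP; rewrite /= -e.
- apply/forallP=> z; have [zR|zR] := boolP (z \in map io c).
    have := chain_map_lt zR; rewrite /row_lt /box_le => /orP[->//|/andP[/eqP e lt]].
    by rewrite /blk /idx e eqxx (ltnW lt) orbT.
  have [e|zx] := eqVneq z x1E; last by rewrite chain_map_id ?inE ?negb_or ?zx // /box_le eqxx leqnn orbT.
  have := @chain_map_x1; rewrite -(mem_map io_inj) -e zR => /(_ isT) e'.
  rewrite /brow in e'; rewrite /box_le /blk /idx e' e /=.
  by rewrite eqxx leqnn orbT.
- by apply/forall_inP=> z; rewrite inR row_lt_box; exact: chain_map_lt.
- apply/subsetP=> z; rewrite set_YE !inE => /eqP ->; apply/exists_inP; exists x1E.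
    by rewrite set_XE inE.
  by rewrite chain_connect chain_orbit_mem eqxx !orbT.
- apply/eqP/setP => z; rewrite in_setU RX set_YE !inE.
  have -> : [exists x in set_X N w h b1, fconnect (chain_map c) x z] = (z \in chain_orbit c).
    rewrite set_XE; apply/exists_inP/idP => [[x]|zo].
      by rewrite inE => /eqP ->; rewrite chain_connect.
    by exists x1E; rewrite ?inE // chain_connect.
  by rewrite chain_orbit_mem orbA.
- apply/forall_inP=> z; rewrite inR => zR; apply/forall_inP => z'; rewrite inR => zR'.
  apply/implyP => /and4P[/eqP eb lt _ _]; apply: chain_map_mono => //.
  by rewrite /row_lt -/(blk _) -/(blk (val z')) eb eqxx [X in _ || X]lt orbT.
- apply/forall_inP=> z; rewrite in_setC RX => zn; rewrite chain_map_id //.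
apply/eqP/setP => z.
have -> : (z \in ([set z in map io c] :\: set_X N w h b1) :|: set_Y N w h)
    = (z \in rcons (map io (chain_tail c)) y1E).
  rewrite set_XE set_YE in_setU in_setD inR !in_set1; have [->|zx] := eqVneq z x1E.
    have /andP[/negPf-> _] := chain_orbit_uniq; exact/negbTE/io_y1.
  by have := chain_orbit_mem z; rewrite in_cons (negPf zx) /= => ->.
rewrite -(path_frel_map chain_map_path); apply/imsetP/mapP => -[u uR ->]; exists u => //.
  by move: uR; rewrite RX -chain_tail_mem.
by rewrite RX -chain_tail_mem.
Qed.

End Chain.
(** A chain is recovered from its set of boxes, which its rows put in order. *)
Lemma chain_path_inj c c' : is_chain c -> is_chain c' ->
  chain_path c = chain_path c' -> c = c'.
Proof.
move=> [[cs _ _] _] [[cs' _ _] _] [_ /setP eR].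
apply: (@irr_sorted_eq _ (relpre (fun d : lam => brow (val d)) row_lt)).
- by move=> x u v; apply: row_lt_trans.
- by move=> x; apply: row_lt_irr.
- by rewrite -sorted_map.
- by rewrite -sorted_map.
by move=> d; have := eR (io d); rewrite !inE !(mem_map io_inj).
Qed.

(** Since y_1 is a fixed point in the orbit of x_1, this orbit is a sequence ending in y_1.
    By the description of the orbit in the definition of 1-paths, its members other than y_1,
    and possibly x_1, form the evacuation route; they are in increasing order
    because a 1-path moves the boxes of its route strictly upwards. *)
Lemma one_path_chain P R : one_path b1 (P, R) -> exists2 c, is_chain c & (P, R) = chain_path c.
Proof.
rewrite /one_path set_XE set_YE => /and5P[ev Ple Plt Y1 /and4P[/eqP R1 _ Pid /eqP PRX]].
have /and4P[RY Rb1 Runiq Rcl] := ev.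
have {}RY : y1E \notin R.
  by move/subsetP: RY => RY; apply/negP => /RY; rewrite set_YE !inE eqxx.
have {}R1 z : (z \in R :|: [set x1E] :|: [set y1E]) = (z \in fingraph.orbit P x1E).
  rewrite R1 !inE -fconnect_orbit; apply/exists_inP/idP => [[x]|zx].
    by rewrite inE => /eqP->.
  by exists x1E; rewrite ?inE.
have {}Pid z : z \notin R -> z != x1E -> P z = z.
  by move=> zR zx; apply/eqP; move/forall_inP: Pid; apply; rewrite !inE negb_or zR.
have Py : P y1E = y1E by apply: Pid => //; rewrite eq_sym io_y1.
have yO : y1E \in fingraph.orbit P x1E by rewrite -R1 !inE eqxx orbT.
have [k ok ek] : exists2 k, (k < fingraph.order P x1E)%N & y1E = iter k P x1E.
  by move: yO; rewrite /fingraph.orbit => /trajectP.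
(* After reaching the fixed point y_1 the orbit cannot continue. *)
have oE : fingraph.orbit P x1E = rcons (traject P x1E k) y1E.
  rewrite [y1E in RHS]ek -trajectSr /fingraph.orbit; congr traject.
  apply/eqP; rewrite eqn_leq ok andbT leqNgt; apply/negP => kk.
  have := fingraph.orbit_uniq P x1E; rewrite /fingraph.orbit => /(nth_uniq x1E) u.
  have := u k k.+1; rewrite size_traject !nth_traject // => /(_ ok kk).
  by rewrite /= -ek Py eqxx => /esym/eqP /n_Sn.
case: k => [|k] in ok ek oE; first by have := io_y1 x1D; rewrite -[x1E]ek eqxx.
rewrite trajectS in oE; set q := traject P (P x1E) k in oE.
have uO : uniq (x1E :: rcons q y1E) by rewrite -[_ :: _]oE fingraph.orbit_uniq.
have {}R1 z : (z \in R :|: [set x1E] :|: [set y1E]) = (z \in x1E :: rcons q y1E).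
  by rewrite R1 oE.
have qR z : (z \in q) = (z \in R) && (z != x1E).
  have := R1 z; rewrite !inE mem_rcons inE.
  have [->|zx] := eqVneq z x1E.
    move: uO; rewrite /= mem_rcons inE negb_or andbF => /andP[/andP[_ /negPf->]] //.
  rewrite andbT orbF /=; have [->|zy] := eqVneq z y1E; last by rewrite orbF.
  by move: uO; rewrite /= rcons_uniq (negPf RY) => /and3P[_ /negPf->].
have [c ec] : exists c, (if x1E \in R then x1E :: q else q) = map io c.
  apply: seq_preim; apply: contra RY; case: ifP => xR; rewrite ?inE ?qR; last by case/andP.
  by case/orP=> [/eqP yx|/andP[]//]; have := io_y1 x1D; rewrite yx eqxx.
have cR z : (z \in map io c) = (z \in R).
  rewrite -ec; case: ifP => xR; rewrite ?inE qR; have [->|zx] := eqVneq z x1E;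
    by rewrite ?andbT ?andbF ?xR.
have x1c : (x1D \in c) = (x1E \in R) by rewrite -cR (mem_map io_inj).
have pq : path (frel P) x1E (rcons q y1E).
  have -> : rcons q y1E = traject P (P x1E) k.+1 by rewrite ek iterSr trajectSr.
  exact: fpath_traject.
have fc : sorted (frel P) (map io c).
  rewrite -ec; move: pq; rewrite rcons_path => /andP[pq _].
  by case: ifP => _ //; apply: path_sorted pq.
have tlE : map io (chain_tail c) = q.
  rewrite /chain_tail x1c; move: ec; case: ifP => // _.
  by case: (c) => [|d c'] //= [].
have cc : is_chain c.
  have [d dR ed] : exists2 d, d \in c & brow (val d) = (b1, 1%N).
    case/exists_inP: Rb1 => z; rewrite -cR => /mapP[d dc ->] /eqP e; by exists d.
  split; last by rewrite -ed; apply: map_f.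
  have xle i : (b1 <= (brow (val (iter i P x1E))).1)%N.
    elim: i => [|i IHi] //=; apply: (leq_trans IHi).
    have := forallP Ple (iter i P x1E).
    by rewrite /box_le => /orP[/ltnW//|/andP[/eqP e _]]; rewrite -[X in (_ <= X)%N]e.
  split.
  - have -> : rows_of c = [seq brow (val z) | z <- map io c] by rewrite -map_comp.
    rewrite sorted_map; apply: (sub_in_sorted (P := mem R)) fc.
      by move=> z z' zR _ /= /eqP <-; move/forall_inP: Plt; apply.
    by apply/allP => z; rewrite cR.
  - move=> r /mapP[d' dc' ->]; rewrite lam_valid /=.
    have := R1 (io d'); rewrite !in_setU -cR map_f //= -[_ :: _]oE.
    by move/esym; rewrite /fingraph.orbit => /trajectP[i _ e]; have := xle i; rewrite -e.
  move=> r /mapP[d' dc' ->] i /andP[i0 ir].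
  have := forall_inP Rcl (io d'); rewrite -cR map_f // => /(_ isT)/forallP/(_ (Ordinal ir)).
  rewrite /= i0 => /exists_inP[z]; rewrite -cR => /mapP[u uc ->] /eqP <-.
  exact: map_f.
exists c => //; rewrite /chain_path; congr pair; last first.
  by apply/setP => z; rewrite inE cR.
apply/ffunP => z; rewrite ffunE /chain_orbit tlE.
set o := x1E :: _; case: ifP => [zo|/negbT zo]; last first.
  move: zo; rewrite /o -R1 !inE !negb_or => /andP[/andP[zR zx] _]; exact: Pid.
have [io'|io'] := ltnP (index z o) (size (rcons q y1E)).
  by have /eqP := pathP y1E pq (index z o) io'; rewrite /= -/o nth_index.
have zl : index z o = size (rcons q y1E).
  by apply/eqP; rewrite eqn_leq io' andbT -ltnS -[X in (_ < X)%N]/(size o) index_mem.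
rewrite nth_default ?zl // -{1}(nth_index y1E zo) zl.
by rewrite /o /= size_rcons /= nth_rcons ltnn eqxx Py.
Qed.

End Paths.

(** * The action of a 1-path on fillings *)

Section TensorBilinear.

Variables (K : fieldType) (V W : vectType K).

Lemma tmul_linearl (t : W) : linear (fun v : V => tmul v t).
Proof.
by move=> a u v; rewrite /tmul passmx.rVof_linear linearD /= linearZ /= mulmxDl -scalemxAl.
Qed.

Lemma tmul_linearr (v : V) : linear (fun t : W => tmul v t).
Proof. by move=> a u t; rewrite /tmul passmx.rVof_linear mulmxDr -scalemxAr. Qed.

Lemma tmul_suml (I : finType) (a : I -> K) (v : I -> V) (t : W) :
  tmul (\sum_i a i *: v i) t = \sum_i a i *: tmul (v i) t.
Proof.
pose L := HB.pack (fun v : V => tmul v t) (GRing.isLinear.Build K _ _ _ _ (tmul_linearl t)) : {linear V -> tens V W}.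
rewrite -[LHS]/(L _) linear_sum; apply: eq_bigr => i _.
by rewrite linearZ.
Qed.

Lemma tmul_sumr (I : finType) (a : I -> K) (v : V) (t : I -> W) :
  tmul v (\sum_i a i *: t i) = \sum_i a i *: tmul v (t i).
Proof.
pose L := HB.pack (fun t : W => tmul v t) (GRing.isLinear.Build K _ _ _ _ (tmul_linearr v)) : {linear W -> tens V W}.
rewrite -[LHS]/(L _) linear_sum; apply: eq_bigr => i _.
by rewrite linearZ.
Qed.

End TensorBilinear.

Section PathSums.

Variables (N : nat) (w h : nat -> nat) (b1 : nat).
Hypotheses (x1_lam : box_x1 w b1 \in diagram N w h) (b1_ok : (0 < b1 <= N)%N).

Local Notation lam := (diagram N w h).
Local Notation mu := (diagram N w h `\ box_x1 w b1).
Local Notation E := (ediagram N w h).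
Local Notation y := (N.+1, 1%N).
Local Notation io := (@inE_lam N w h).
Local Notation x1E := (io (x1D x1_lam)).
Local Notation y1E := (y1E N w h).

Lemma sum_one_path (V : nmodType) (F : {ffun E -> E} * {set E} -> V) :
  \sum_(PR | one_path b1 PR) F PR
  = \sum_(s <- head_routes h (N - b1) b1) \sum_(c <- picks lam s)
      F (chain_path x1_lam c).
Proof.
pose chains := [seq c | s <- head_routes h (N - b1) b1, c <- picks lam s].
have [b1_gt0 b1N] := andP b1_ok.
have hN : (N - b1 + b1 = N)%N by rewrite subnK.
have chainsP c : reflect (is_chain b1 c) (c \in chains).
  apply: (iffP idP) => [/allpairsPdep[s [c' [sr cs ->]]]|cc].
    by move: sr cs; rewrite mem_picks => /head_routesP sr /eqP e; rewrite /is_chain e; apply: sr.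
  apply/allpairsPdep; exists (rows_of c), c; split=> //; last by rewrite mem_picks.
  by apply/(@head_routesP N h (N - b1) b1).
have uc : uniq chains.
  apply: allpairs_uniq_dep.
  - by apply: uniq_block_cat => //; apply: uniq_routes => //; rewrite addnS hN.
  - by move=> s _; apply: uniq_picks.
  move=> _ _ /allpairsPdep[s [c [_ cs ->]]] /allpairsPdep[s' [c' [_ cs' ->]]] /= e.
  by move: cs cs'; rewrite !mem_picks e => /eqP <- /eqP <-.
transitivity (\sum_(PR <- [seq chain_path x1_lam c | c <- chains]) F PR).
  rewrite -big_enum; apply: perm_big; apply: uniq_perm.
  - exact: enum_uniq.
  - rewrite map_inj_in_uniq // => c c' /chainsP cc /chainsP cc'.
    exact: chain_path_inj.
  move=> [P R]; rewrite mem_enum; apply/idP/mapP => [/(one_path_chain x1_lam)[c cc ->]|[c /chainsP cc ->]].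
    by exists c => //; apply/chainsP.
  exact: chain_path_one_path.
by rewrite big_map big_allpairs_dep.
Qed.

Section Bijection.

Variables (P : {ffun E -> E}) (R : {set E}).
Hypothesis PR : one_path b1 (P, R).

Let RY : y1E \notin R.
Proof.
have /and5P[/and4P[/subsetP RY _ _ _] _ _ _ _] := PR.
by apply/negP => /RY; rewrite set_YE !inE eqxx.
Qed.

Let Pid z : z \notin R -> z != x1E -> P z = z.
Proof.
have /and5P[_ _ _ _ /and4P[_ _ /forall_inP Pid _]] := PR => zR zx.
by apply/eqP; apply: Pid; rewrite (set_XE x1_lam) !inE negb_or zR.
Qed.

Let PRX : P @: (R :|: [set x1E]) = R :\ x1E :|: [set y1E].
Proof.
have /and5P[_ _ _ _ /and4P[_ _ _ /eqP]] := PR.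
by rewrite (set_XE x1_lam) set_YE.
Qed.

(** On R and X the map is injective because its image has as many elements as R and X;
    elsewhere it is the identity, and the two images do not meet inside lambda. *)
Lemma one_path_inj d d' : P (io d) = P (io d') -> d = d'.
Proof.
have cardS : #|P @: (R :|: [set x1E])| == #|R :|: [set x1E]|.
  rewrite PRX !(setUC _ [set _]) !cardsU1 (cardsD1 x1E R) !inE (negPf RY) andbF.
  by case: (x1E \in R); rewrite /= ?add0n ?add1n.
have inj := elimT imset_injP cardS.
have out (u u' : lam) : io u \in R :|: [set x1E] -> io u' \notin R :|: [set x1E] ->
    P (io u) <> P (io u').
  move=> uS; rewrite !inE negb_or => /andP[uR ux]; rewrite [P (io u')]Pid // => e.
  have : P (io u) \in R :\ x1E :|: [set y1E] by rewrite -PRX imset_f.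
  by rewrite e !inE (negPf uR) andbF /= (negPf (io_y1 u')).
have [uS|uS] := boolP (io d \in R :|: [set x1E]); have [uS'|uS'] := boolP (io d' \in R :|: [set x1E]).
- by move/(inj _ _ uS uS')/io_inj.
- by move/(out _ _ uS uS').
- by move/esym/(out _ _ uS' uS).
move: uS uS'; rewrite !inE !negb_or => /andP[? ?] /andP[? ?].
by rewrite !Pid // => /io_inj.
Qed.

Lemma one_path_x1 d : P (io d) <> x1E.
Proof.
move=> e; have [dS|] := boolP (io d \in R :|: [set x1E]); last first.
  by rewrite !inE negb_or => /andP[dR dx]; have := dx; rewrite -(Pid dR dx) e eqxx.
have : P (io d) \in R :\ x1E :|: [set y1E] by rewrite -PRX imset_f.
by rewrite e !inE eqxx /= (negPf (io_y1 _)).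
Qed.

Lemma one_path_surj z : z != x1E -> exists d, P (io d) = z.
Proof.
move=> zx; have [zS|zS] := boolP (z \in R :\ x1E :|: [set y1E]).
  move: zS; rewrite -PRX => /imsetP[u uS ->].
  case: (E_case u) uS => [->|[d ->] _]; last by exists d.
  by rewrite !inE (negPf RY) /= => /eqP e; have := io_y1 (x1D x1_lam); rewrite e eqxx.
move: zS; rewrite !inE zx /= negb_or => /andP[zR zy].
case: (E_case z) zy zx zR => [->|[d ->] _ dx dR]; first by rewrite eqxx.
by exists d; rewrite Pid.
Qed.

Lemma path_sourceP z : z != x1E ->
  exists2 d, path_source P (val z) = Some d & P (io d) = z.
Proof.
move=> /one_path_surj[d Pd]; rewrite /path_source; case: pickP => [d' /eqP e|/(_ d)].
  by exists d' => //; apply: val_inj.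
by rewrite -Pd eqxx.
Qed.

Definition source (c : mu) : lam :=
  odflt (fincl (fsubD1set _ _) c) (path_source P (val c)).

Lemma sourceP c : val (P (io (source c))) = val c.
Proof.
pose c' : lam := fincl (fsubD1set _ _) c.
have cx : io c' != x1E.
  apply/eqP=> /(congr1 val) /= e; have := valP c.
  by rewrite in_fsetD1 => /andP[/eqP].
have [d sd Pd] := path_sourceP cx.
by rewrite /source sd /= Pd.
Qed.

Definition top_source : lam := odflt (x1D x1_lam) (path_source P (box_y1 N)).

Lemma top_sourceP : P (io top_source) = y1E /\ path_source P (box_y1 N) = Some top_source.
Proof.
have yx : y1E != x1E by rewrite eq_sym io_y1.
have [d sd Pd] := path_sourceP yx.
by rewrite /top_source sd.
Qed.

Lemma source_cover d : d != top_source -> exists c, d = source c.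
Proof.
move=> dt; have Pd : val (P (io d)) \in mu.
  rewrite in_fsetD1; apply/andP; split.
    by apply/eqP=> e; apply: (@one_path_x1 d); apply: val_inj.
  case: (E_case (P (io d))) => [e|[u ->]]; last exact: (valP u).
  by move: dt; rewrite (@one_path_inj d top_source) ?eqxx // e top_sourceP.1.
by exists [` Pd]; apply: one_path_inj; apply: val_inj; rewrite sourceP.
Qed.

(** The boxes of lambda are the sources of y_1 and of the boxes of mu. *)
Lemma big_source (V : Type) (idx : V) (op : Monoid.com_law idx) (F : lam -> V) :
  \big[op/idx]_(d : lam) F d
  = op (F top_source) (\big[op/idx]_(c : mu) F (source c)).
Proof.
rewrite (bigD1 top_source) //=; congr (op _ _).
rewrite -(big_imset (h := source) F) /=; last first.
  by move=> c c' _ _ /(congr1 (fun d => val (P (io d)))); rewrite !sourceP => /val_inj.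
apply: eq_bigl => d; apply/idP/imsetP => [/source_cover[c ->]|[c _ ->]].
  by exists c.
apply/eqP=> e; have := sourceP c; rewrite e top_sourceP.1 /= => e'.
have : fsval c \in lam by have := valP c; rewrite in_fsetD1 => /andP[].
by rewrite -e' /box_y1 mem_diagram ltnn.
Qed.

Lemma path_entryE (K : fieldType) (V : vectType K) (n : nat) (e : n.-tuple V)
    (T : filling lam n) : path_entry e P T = tnth e (T top_source).
Proof. by rewrite /path_entry top_sourceP.2. Qed.

(** In T_P the entry of a box [d] of lambda is found in the row of the image of [d]; for the
    entry that leaves lambda this is the row of y_1. *)
Lemma path_content (n : nat) (T : filling lam n) :
  unit_content y (T top_source) + content_of (path_filling b1 P T)
  = \sum_(d : lam) unit_content (brow (val (P (io d)))) (T d).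
Proof.
rewrite [RHS]big_source top_sourceP.1; congr (_ + _).
by apply: eq_bigr => c _; rewrite sourceP /box_content ffunE.
Qed.

Lemma path_split_bij (n : nat) :
  bijective (fun T : filling lam n => (T top_source, path_filling b1 P T)).
Proof.
apply: inj_card_bij => [T T' [e /ffunP e']|].
  apply/ffunP => d; have [->//|/source_cover[c ->]] := eqVneq d top_source.
  by have := e' c; rewrite !ffunE.
have -> : #|{: filling lam n}| = (n * #|{: filling mu n}|)%N.
  rewrite !card_ffun card_ord -expnS; congr (_ ^ _)%N.
  by rewrite -!sum1_card big_source /= add1n.
by rewrite card_prod card_ord.
Qed.

(** A filling of lambda amounts to an entry for y_1 and a filling of mu, and the coefficient
    of a filling in the image under [g] is a product that splits accordingly. *)
Lemma path_equivariant (K : fieldType) (V : vectType K) (n : nat) (e : n.-tuple V)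
    (g : 'End(V)) (T : filling lam n) : basis_of fullv e ->
  \sum_(S : filling lam n) (\prod_(x : lam) coord e (S x) (g (tnth e (T x))))
     *: tmul (path_entry e P S) (fbas K (path_filling b1 P S))
  = tmul (g (path_entry e P T)) (fact e mu g (fbas K (path_filling b1 P T))).
Proof.
move=> he; rewrite path_entryE fext_bas.
pose F (p : 'I_n * filling mu n) := (coord e p.1 (g (tnth e (T top_source)))
    * \prod_(c : mu) coord e (p.2 c) (g (tnth e (T (source c)))))
  *: tmul (tnth e p.1) (fbas K p.2).
transitivity (\sum_(S : filling lam n) F (S top_source, path_filling b1 P S)).
  apply: eq_bigr => S _; rewrite /F path_entryE big_source; congr (_ * _ *: _).
  by apply: eq_bigr => c _; rewrite ffunE.
transitivity (\sum_p F p).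
  by rewrite [RHS](reindex _ (onW_bij _ (path_split_bij n))).
rewrite -(pair_bigA _ (fun u S => F (u, S))).
rewrite {1}(coord_basis he (memvf (g (tnth e (T top_source))))).
rewrite tmul_suml; apply: eq_bigr => u _; rewrite tmul_sumr scaler_sumr.
apply: eq_bigr => S _; rewrite scalerA /F /= -(tnth_nth 0); congr (_ * _ *: _).
by apply: eq_bigr => c _; rewrite ffunE.
Qed.

End Bijection.
End PathSums.

(** * Tensor products with the quotient *)

Section TensorKernel.

Variables (K : fieldType) (V W : vectType K).

Definition tens_row (s : tens V W) (i : 'I_(\dim {:V})) : W :=
  passmx.vecof (vbasis {:W}) (row i (s : 'M_(_, _))).

Lemma tens_decomp (s : tens V W) :
  s = \sum_i tmul (tnth (vbasis {:V}) i) (tens_row s i).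
Proof.
apply/matrixP => a b; rewrite summxE (bigD1 a) //= big1 => [|i ia].
  rewrite addr0 /tmul passmx.vecofK ?vbasisP // (tnth_nth 0) passmx.rVofE ?vbasisP //.
  by rewrite trmx_delta mxE big_ord1 !mxE !eqxx mul1r.
rewrite /tmul (tnth_nth 0) passmx.rVofE ?vbasisP //.
by rewrite trmx_delta mxE big_ord1 !mxE eq_sym (negPf ia) mul0r.
Qed.

Lemma tensv_mem (A : {vspace V}) (B : {vspace W}) v t :
  v \in A -> t \in B -> tmul v t \in tensv A B.
Proof.
move=> vA tB; rewrite (coord_vbasis vA) (coord_vbasis tB) tmul_suml.
apply: memv_suml => i _; rewrite memvZ // tmul_sumr.
apply: memv_suml => j _; rewrite memvZ // memv_span //.
by apply: allpairs_f; rewrite mem_nth ?size_tuple.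
Qed.

(** Tensoring with V is exact: the components of a tensor with respect to a basis of V can be
    considered separately. *)
Lemma tmap_proj_ker (U : {vspace W}) (s : tens V W) :
  tmap \1%VF (qproj U) s = 0 -> s \in tensv fullv U.
Proof.
move=> s0; rewrite (tens_decomp s); apply: memv_suml => i _.
apply: tensv_mem; rewrite ?memvf // -(qproj_ker U) memv_ker.
have /matrixP := s0; rewrite {1}(tens_decomp s) linear_sum /=.
under eq_bigr => j _ do rewrite tmap_tmul id_lfunE.
move=> s0'; rewrite -(passmx.rVof_eq0 (vbasisP _)); apply/eqP/rowP => b.
have := s0' i b; rewrite summxE (bigD1 i) //= big1 => [|j ji]; last first.
  rewrite /tmul (tnth_nth 0) passmx.rVofE ?vbasisP //.
  by rewrite trmx_delta mxE big_ord1 !mxE eq_sym (negPf ji) mul0r.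
rewrite addr0 /tmul (tnth_nth 0) passmx.rVofE ?vbasisP //.
by rewrite trmx_delta mxE big_ord1 !mxE !eqxx mul1r.
Qed.

End TensorKernel.

(** * The map on Schur modules *)

Section Main.

Variables (K : fieldType) (V : vectType K) (n : nat) (e : n.-tuple V).
Variables (N : nat) (w h : nat -> nat) (b1 : nat).
Hypothesis char0 : [pchar K] =i pred0.
Hypothesis w_gt0 : (0 < w 1)%N.
Hypothesis w_lt : forall b, (1 <= b < N)%N -> (w b < w b.+1)%N.
Hypothesis h_gt0 : forall b, (1 <= b <= N)%N -> (0 < h b)%N.
Hypothesis b1_ok : (0 < b1 <= N)%N.

Local Notation lam := (diagram N w h).
Local Notation mu := (diagram N w h `\ box_x1 w b1).
Local Notation E := (ediagram N w h).
Local Notation y := (N.+1, 1%N).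
Local Notation io := (@inE_lam N w h).
Local Notation Phi := (Phi1 e N w h b1).
Local Notation Q := (tens V (schur K mu n)).
Local Notation U := (content n -> Q).
Local Notation D := (fun a b : row_index => polar a b : {linear U -> U}).

Lemma w_mono b b' : (1 <= b)%N -> (b <= b' <= N)%N -> (w b <= w b')%N.
Proof.
move=> b0 /andP[]; elim: b' => [|b' IHb']; first by rewrite leqn0 => /eqP->.
rewrite leq_eqVlt => /orP[/eqP->//|]; rewrite ltnS => bb' bN.
by apply: leq_trans (IHb' bb' (ltnW bN)) _; apply/ltnW/w_lt; lia.
Qed.

Lemma w_pos b : (1 <= b <= N)%N -> (0 < w b)%N.
Proof. by move=> bN; apply: leq_trans w_gt0 (w_mono _ _); lia. Qed.

Lemma x1_lam : box_x1 w b1 \in lam.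
Proof. by rewrite /box_x1 mem_diagram b1_ok h_gt0 // w_pos //= leqnn. Qed.

Definition chain_coef (b : nat) : K := (hook_sum w h b1 b)%:R^-1.

Definition mu_class : U := class_fun y
  (fun v T => tmul (tnth e v) (schur_proj K mu n (fbas K T))).

(** The sum over all 1-paths in operator form, applied to [mu_class]. *)
Definition Phi_class : U := block_sum D h chain_coef (N - b1) b1 mu_class.

Lemma mu_y (c : mu) : brow (val c) != y.
Proof.
have : val c \in lam by have := valP c; rewrite in_fsetD1 => /andP[].
by move=> cl; apply: (lam_y [` cl]).
Qed.

Lemma schur_row_equiv (T1 T2 : filling mu n) : row_equiv T1 T2 ->
  schur_proj K mu n (fbas K T1) = schur_proj K mu n (fbas K T2).
Proof.
move=> e12; apply/eqP; rewrite -subr_eq0 -linearB -memv_ker qproj_ker.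
apply: (subvP (addvSl _ _)); apply: memv_span; apply/imageP.
by exists (T1, T2).
Qed.

Lemma schur_gsum (A : {set mu}) (T : filling mu n) : (width A < #|A|)%N ->
  schur_proj K mu n (gsum K A T) = 0.
Proof.
move=> wA; apply/eqP; rewrite -memv_ker qproj_ker.
apply: (subvP (addvSr _ _)); apply: memv_span; apply/imageP.
by exists (A, T).
Qed.

Lemma tmul_sum0 (v : V) (I : finType) (P : pred I) (t : I -> schur K mu n) :
  \sum_(i | P i) t i = 0 -> \sum_(i | P i) tmul v (t i) = 0.
Proof.
pose L := HB.pack (fun t : schur K mu n => tmul v t)
  (GRing.isLinear.Build K _ _ _ _ (@tmul_linearr _ _ _ v))
  : {linear schur K mu n -> tens V (schur K mu n)}.
by move=> s0; rewrite -[LHS](linear_sum L) s0 linear0.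
Qed.

Lemma shift_sum (P : E -> E) (T : filling lam n) (c : seq lam) :
  sorted (frel P) (rcons (map io c) (y1E N w h)) ->
  \sum_(d <- c) (unit_content (brow (val (P (io d)))) (T d) - box_content T d)
  = shift y T c.
Proof.
elim: c => [|d c IHc]; first by rewrite big_nil.
rewrite big_cons => /= ps; rewrite -IHc; last exact: path_sorted ps.
congr (_ - _ + _); congr unit_content.
by case: (c) ps => [|d' c'] /= /andP[/eqP -> _].
Qed.

Lemma chain_content (T : filling lam n) (c : seq lam) : is_chain b1 c ->
  \sum_(d : lam) unit_content (brow (val (chain_map x1_lam c (io d)))) (T d)
  = content_of T + shift y T c.
Proof.
move=> cc; rewrite -(shift_sum T (chain_map_sorted x1_lam cc)).
apply/eqP; rewrite addrC -subr_eq /content_of -sumrB; apply/eqP.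
have uc : uniq c.
  case: cc => [[cs _ _] _].
  exact: map_uniq (sorted_uniq row_lt_trans row_lt_irr cs).
rewrite (big_uniq _ uc) [X in _ = X]big_mkcond; apply: eq_bigr => d _.
case: ifP => // /negbT dc.
rewrite /box_content; have [e1|dx] := eqVneq d (x1D x1_lam).
  by rewrite e1 (chain_map_x1 cc) ?subrr // -e1.
rewrite (chain_map_id cc) ?subrr //.
by rewrite inE negb_or (inj_eq (@io_inj _ _ _)) dx (mem_map (@io_inj _ _ _)).
Qed.

Lemma path_height_chain (c : seq lam) : is_chain b1 c ->
  path_height (chain_path x1_lam c).2 = size c.
Proof.
move=> cc; have uc : uniq (rows_of c).
  by case: cc => [[cs _ _] _]; apply: (sorted_uniq row_lt_trans row_lt_irr cs).
rewrite /path_height -(size_map (fun d : lam => brow (val d))).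
apply: perm_size; apply: uniq_perm; rewrite ?undup_uniq // => r.
rewrite mem_undup; apply/mapP/mapP => [[z]|[d dc ->]].
  by rewrite mem_enum inE => /mapP[d dc ->] ->; exists d.
by exists (io d) => //; rewrite mem_enum inE map_f.
Qed.

Lemma path_weight_chain (c : seq lam) :
  (-1) ^+ size c / (path_weight b1 (chain_path x1_lam c).2)%:R
  = route_coef N chain_coef b1.+1 (rows_of c).
Proof.
rewrite /route_coef size_map; congr (_ * _).
rewrite /path_weight natr_prod -prodfV; apply: eq_big_nat => b _.
have -> : [exists z in (chain_path x1_lam c).2, blk (val z) == b]
    = has (fun r : row_index => r.1 == b) (rows_of c).
  rewrite has_map; apply/exists_inP/hasP => [[z]|[d dc db]].
    by rewrite inE => /mapP[d dc ->] db; exists d.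
  by exists (io d) => //; rewrite inE map_f.
by case: ifP; rewrite // invr1.
Qed.

Lemma mu_class_pair v (T : filling mu n) :
  mu_class (unit_content y v + content_of T)
  = tmul (tnth e v) (schur_proj K mu n (fbas K T)).
Proof.
by apply: class_funE => [|u T1 T2 /schur_row_equiv->//]; exact: mu_y.
Qed.

(** Both sides are sums over the chains of boxes: the left one by the description
    of 1-paths, the right one by the expansion of the operators. The content of P(T) is that
    of [T] shifted along the chain. *)
Lemma Phi_eval (T : filling lam n) :
  tmap \1%VF (schur_proj K mu n) (Phi (fbas K T)) = Phi_class (content_of T).
Proof.
have [b10 b1N] := andP b1_ok; have hN : (N - b1 + b1 = N)%N by rewrite subnK.
rewrite fext_bas linear_sum /= (sum_one_path x1_lam b1_ok) /Phi_class.
rewrite (block_sum_routes h D chain_coef mu_class hN b10) fct_sumE.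
apply: eq_big_seq => s /(@head_routesP N h _ _ _ hN b10)[sr sb].
have es := is_route_head sr sb; rewrite fctE /walk (@steps_picks _ _ _ _ _ T); last 4 first.
- by rewrite -es; case: sr => ss _ _; apply: (sorted_uniq row_lt_trans row_lt_irr ss).
- by rewrite -es; apply/negP=> ys; case: sr => _ /(_ _ ys) + _; rewrite /valid_row /= ltnn.
- exact: nonneg_content.
- by [].
rewrite -es scaler_sumr; apply: eq_big_seq => c; rewrite mem_picks => /eqP ec.
have cc : is_chain b1 c by rewrite /is_chain ec.
have op := chain_path_one_path x1_lam b1_ok cc.
rewrite linearZ path_height_chain // path_weight_chain ec; congr (_ *: _).
rewrite /= tmap_tmul id_lfunE (path_entryE x1_lam op).
rewrite -mu_class_pair; congr mu_class.
by rewrite (path_content x1_lam op) chain_content.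
Qed.

(** The row of x_1 has lost one box. *)
Definition mu_len (r : row_index) : nat := (w r.1 - (r == (b1, 1%N)))%N.

Lemma row_len_seq (B : {fset box}) (r : row_index) (s : seq box) : uniq s ->
  (forall x, (x \in s) = (x \in B) && (brow x == r)) -> row_len B r = size s.
Proof.
move=> us sE; rewrite /row_len cardE -(size_map val).
apply: perm_size; apply: uniq_perm => //.
  by rewrite map_inj_uniq ?enum_uniq //; apply: val_inj.
move=> x; rewrite sE; apply/mapP/andP => [[z]|[xB xr]].
  by rewrite mem_enum inE => zr ->; split=> //; apply: valP.
by exists [` xB]; rewrite ?mem_enum ?inE.
Qed.

Lemma lam_row_len r : valid_row N h r -> row_len lam r = w r.1.
Proof.
case: r => b i /andP[/= bN ih]; rewrite (@row_len_seq _ _ [seq (b, i, j) | j <- iota 1 (w b)]).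
- by rewrite size_map size_iota.
- by rewrite map_inj_uniq ?iota_uniq // => j j' [].
move=> [[b' i'] j]; rewrite mem_diagram; apply/mapP/andP => [[j']|[/and3P[_ _ jw] /eqP[<- <-]]].
  by rewrite mem_iota add1n ltnS => jw [-> -> ->]; rewrite bN ih jw eqxx.
by exists j; rewrite // mem_iota add1n ltnS.
Qed.

Lemma mu_row_len r : valid_row N h r -> row_len mu r = mu_len r.
Proof.
case: r => b i /andP[/= bN ih].
rewrite (@row_len_seq _ _ [seq (b, i, j) | j <- iota 1 (mu_len (b, i))]).
- by rewrite size_map size_iota.
- by rewrite map_inj_uniq ?iota_uniq // => j j' [].
have wb := w_pos bN.
move=> [[b' i'] j]; rewrite in_fsetD1 mem_diagram /mu_len /box_x1 !xpair_eqE /=.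
apply/mapP/andP => [[j']|[/andP[jx /and3P[_ _ jw]] /andP[/eqP eb /eqP ei]]].
  rewrite mem_iota add1n ltnS => jw [-> -> ->]; rewrite bN ih !eqxx; split=> //.
  by move: jw; case: eqP => [eb|]; case: eqP => [ei|] //=; subst; lia.
exists j; last by rewrite eb ei.
rewrite mem_iota add1n ltnS; move: jx; rewrite eb ei.
by case: eqP => [eb'|]; case: eqP => [ei'|] //=; subst; lia.
Qed.

(** The set consisting of row [p] and one box of row [q] has more boxes than
    its longest row, so that its symmetrizers are among the relations for mu. *)
Lemma mu_class_exchange p q : valid_row N h p -> valid_row N h q -> p != q ->
  (mu_len q <= mu_len p)%N -> polar p q mu_class = 0.
Proof.
move=> vp vq pq qp.
have neqy r : valid_row N h r -> r != y.
  by apply: contraTneq => ->; rewrite /valid_row /= ltnn.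
apply: class_fun_exchange; rewrite ?neqy //; first exact: mu_y.
  by move=> u T1 T2 /schur_row_equiv->.
move=> v x T xq; apply: tmul_sum0; rewrite -linear_sum; apply: schur_gsum.
have xp : x \notin row_set mu p by rewrite inE xq eq_sym.
rewrite cardsU1 xp add1n ltnS.
have -> : #|row_set mu p| = row_len mu p by apply: eq_card => z; rewrite !inE.
apply/bigmax_leqP => z; rewrite !inE => /orP[/eqP->|/eqP->]; last exact: leqnn.
by rewrite xq !mu_row_len.
Qed.

Lemma mu_class_highest : highest_above D N w h b1 (b1, 1%N) mu_class.
Proof.
have [b10 b1N] := andP b1_ok.
split=> [p q vp vq /andP[bq qp] pq pb|p vp bp].
  apply: mu_class_exchange => //; rewrite /mu_len (negPf pb) subn0.
  apply: leq_trans (leq_subr _ _) _; apply: w_mono; first exact: leq_trans bq.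
  by rewrite qp; case/andP: vp => /andP[].
have -> : D p p mu_class = (row_len mu p)%:R *: mu_class.
  apply: class_fun_weight => //.
  by apply: contraTneq vp => ->; rewrite /valid_row /= ltnn.
rewrite mu_row_len // /mu_len natrB //; case: eqP => //= -> /=.
by apply: w_pos; rewrite b10.
Qed.

Lemma hook_gt0 j : (1 < j <= N)%N -> (0 < hook w h j)%N.
Proof.
case: j => // j jN; rewrite /hook /= addn_gt0 subn_gt0 w_lt //; lia.
Qed.

Lemma hook_sumS b : (b1 <= b)%N -> hook_sum w h b1 b.+1 = (hook_sum w h b1 b + hook w h b.+1)%N.
Proof. by move=> bb; rewrite /hook_sum big_nat_recr. Qed.

Lemma natr_neq0 m : (0 < m)%N -> m%:R != 0 :> K.
Proof. by move=> m0; rewrite (pcharf0P K).1 // -lt0n. Qed.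

Lemma hookE b : (1 <= b < N)%N ->
  (hook w h b.+1)%:R = (h b)%:R + (w b.+1)%:R - (w b)%:R :> K.
Proof.
by move=> bN; rewrite /hook /= natrD natrB 1?ltnW ?w_lt // addrC addrA.
Qed.

Lemma Phi_class_next p q : valid_row N h p -> valid_row N h q -> next_row h q p ->
  polar p q Phi_class = 0.
Proof.
move=> vp vq nqp; have [b10 b1N] := andP b1_ok.
apply: (@block_sum_kill K U D (@polar_comm K Q n) N w h chain_coef h_gt0) => //.
- move=> [//|b] /andP[bb bN]; rewrite invr_eq0 natr_neq0 // hook_sumS //.
  by rewrite addn_gt0 hook_gt0 ?orbT //; lia.
- move=> b /andP[bb bN]; rewrite !invrK hook_sumS 1?ltnW // natrD hookE; last lia.
  by rewrite !addrA.
- move=> bN; rewrite invrK hook_sumS // natrD hookE ?b10 //.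
  by rewrite /hook_sum big_geq // add0r.
- by rewrite subnK.
- exact: mu_class_highest.
move=> qb; apply: mu_class_exchange => //.
  case/orP: nqp => [/eqP->|/andP[_ /eqP->]]; apply/eqP; case: (q) => q1 q2 []; lia.
have qN : (1 <= q.1)%N by case/andP: vq => /andP[].
have bN : (1 <= b1 <= N)%N by [].
rewrite /mu_len; apply: leq_trans (leq_subr _ _) _.
case: eqP => [->|/eqP pb] /=.
  rewrite subn1 -ltnS prednK ?w_pos //.
  (* Here p is the row of x_1. Even without x_1 it is at least as long as
     the rows of lower blocks. *)
  apply: leq_trans (w_lt _) (w_mono _ _); lia.
rewrite subn0; apply: w_mono => //.
by case/orP: nqp vp => [/eqP->|/andP[_ /eqP->]] /andP[/andP[_ /= ->]]; rewrite ?leqnn ?leqnSn.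
Qed.

(** A natural number whose order is the lexicographic order of the rows of lambda. *)
Definition row_rank (r : row_index) : nat := (r.1 * (\max_(b < N.+1) h b).+1 + r.2)%N.

Lemma row_rank_lt p q : valid_row N h p -> valid_row N h q ->
  (row_rank q < row_rank p)%N = row_lt q p.
Proof.
have bd r : valid_row N h r -> (r.2 < (\max_(b < N.+1) h b).+1)%N.
  case/andP=> /andP[_ rN] /andP[_ rh]; rewrite ltnS (leq_trans rh) //.
  exact: (leq_bigmax (Ordinal (rN : (r.1 < N.+1)%N))).
rewrite /row_rank /row_lt => /bd + /bd; case: p q => p1 p2 [q1 q2] /=.
move: (\max_(b < N.+1) h b).+1 => B pB qB.
have [lt|gt|->] := ltngtP q1 p1; last by rewrite ltn_add2l.
  have : (q1.+1 * B <= p1 * B)%N by rewrite leq_mul2r lt orbT.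
  by rewrite mulSn; lia.
have : (p1.+1 * B <= q1 * B)%N by rewrite leq_mul2r gt orbT.
by rewrite mulSn => le; apply/negbTE; rewrite -leqNgt; lia.
Qed.

Lemma next_row_between p q : valid_row N h p -> valid_row N h q -> row_lt q p ->
  exists r, [/\ valid_row N h r, next_row h q r & r = p \/ row_lt r p].
Proof.
case: p q => p1 p2 [q1 q2]; rewrite /valid_row /row_lt /next_row /= => vp vq qp.
have cases (r : row_index) : (r == (p1, p2)) || row_lt r (p1, p2) ->
    r = (p1, p2) \/ row_lt r (p1, p2).
  by case/orP=> [/eqP|]; [left | right].
have [qh|qh] := ltnP q2 (h q1).
  exists (q1, q2.+1); rewrite eqxx /=; split=> //; first lia.
  by apply: cases; rewrite /row_lt xpair_eqE /=; lia.
have qp1 : (q1 < p1)%N.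
  by case/orP: qp => // /andP[/eqP qp1]; rewrite qp1 in qh; lia.
have hq : (0 < h q1.+1)%N by apply: h_gt0; lia.
exists (q1.+1, 1%N); rewrite eqxx andbT /=; split; [lia| |].
  by apply/orP; right; apply/eqP; lia.
by apply: cases; rewrite /row_lt xpair_eqE /=; lia.
Qed.

(** By induction on the distance of the rows: for r between p and q, the operator E_pq
    is a commutator of E_pr and E_rq. *)
Lemma Phi_class_lower p q : valid_row N h p -> valid_row N h q -> row_lt q p ->
  polar p q Phi_class = 0.
Proof.
have [m] := ubnP (row_rank p - row_rank q)%N.
elim: m p q => // m IHm p q pqm vp vq qp.
have [r [vr nqr [<-|rp]]] := next_row_between vp vq qp.
  exact: Phi_class_next.
have qr : row_lt q r.
  case/orP: nqr => [/eqP->|/andP[_ /eqP->]]; rewrite /row_lt /=.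
    by rewrite eqxx ltnSn orbT.
  by rewrite ltnSn.
have rk1 := row_rank_lt vp vr; have rk2 := row_rank_lt vr vq.
rewrite rp in rk1; rewrite qr in rk2.
have pr0 : polar p r Phi_class = 0 by apply: IHm => //; lia.
have rq0 : polar r q Phi_class = 0 by apply: IHm => //; lia.
have := polar_comm p r r q Phi_class; rewrite pr0 rq0 eqxx.
have -> : (p == q) = false.
  by apply/eqP=> pq; move: qp; rewrite pq row_lt_irr.
have z a b : polar a b (0 : U) = 0 by exact: (linear0 (D a b)).
by rewrite !z addr0 sub0r => /esym/eqP; rewrite oppr_eq0 => /eqP.
Qed.

Lemma Phi_class_gsum (A : {set lam}) (T : filling lam n) : (width A < #|A|)%N ->
  gsum_map (fun S => Phi_class (content_of S)) A T = 0.
Proof.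
apply: (content_gsum_kill (rk := row_rank)) => // c d cd.
- have [vc vd] := (lam_valid c, lam_valid d).
  apply/eqP; apply: contraT => ne.
  have := row_rank_lt vc vd; have := row_rank_lt vd vc; rewrite cd ltnn.
  move: ne; case: (brow _) => c1 c2; case: (brow _) => d1 d2.
  by rewrite /row_lt xpair_eqE /=; lia.
- have [vc vd] := (lam_valid c, lam_valid d); rewrite !lam_row_len //.
  have := row_rank_lt vc vd; rewrite ltnNge cd /= => /esym/negbT; rewrite /row_lt negb_or -leqNgt.
  case/andP => le _; apply: w_mono; first by case/andP: vc => /andP[].
  by rewrite le; case/andP: vd => /andP[].
by apply: Phi_class_lower; rewrite -?row_rank_lt ?lam_valid.
Qed.

Lemma Phi_rels (t : fmod K lam n) : t \in rels K lam n ->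
  tmap \1%VF (schur_proj K mu n) (Phi t) = 0.
Proof.
move=> tR; set F := (tmap \1%VF (schur_proj K mu n) \o Phi)%VF.
suff : (rels K lam n <= lker F)%VS.
  by move/subvP/(_ t tR); rewrite memv_ker comp_lfunE => /eqP.
have FE T : F (fbas K T) = Phi_class (content_of T) by rewrite comp_lfunE Phi_eval.
rewrite subv_add; apply/andP; split; apply/span_subvP.
  move=> _ /imageP[[T1 T2] + ->] => /existsP[s /= /andP[/forallP rs /eqP ->]].
  by rewrite memv_ker linearB /= !FE content_perm ?subrr.
move=> _ /imageP[[A T] + ->]; rewrite inE /= => wA; rewrite memv_ker linear_sum /=.
under eq_bigr => s _ do rewrite FE.
by rewrite -/(gsum_map (fun S => Phi_class (content_of S)) A T) Phi_class_gsum.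
Qed.

Lemma Phi_equivariant (he : basis_of fullv e) (g : 'End(V)) (t : fmod K lam n) :
  Phi (fact e lam g t) = tmap g (fact e mu g) (Phi t).
Proof.
rewrite [t]fmod_sum !linear_sum; apply: eq_bigr => T _ /=.
rewrite !linearZ; congr (_ *: _).
have PhiE S : Phi (fbas K S) = \sum_(PR | one_path b1 PR)
    ((-1) ^+ path_height PR.2 / (path_weight b1 PR.2)%:R)
      *: tmul (path_entry e PR.1 S) (fbas K (path_filling b1 PR.1 S)).
  exact: fext_bas.
rewrite /= {1}/fact fext_bas linear_sum /=.
under eq_bigr => S _ do rewrite linearZ /= PhiE scaler_sumr.
rewrite exchange_big PhiE linear_sum /=; apply: eq_bigr => -[P R] PR.
rewrite linearZ /= tmap_tmul -(path_equivariant x1_lam PR g T he).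
rewrite scaler_sumr; apply: eq_bigr => S _.
by rewrite !scalerA mulrC.
Qed.

(** The induced map is obtained by lifting from the quotient; by [Phi_rels] it does not
    depend on the lift. *)
Lemma Phi_descends (he : basis_of fullv e) :
  exists Psi : 'Hom(schur K lam n, tens V (schur K mu n)),
    (forall t, Psi (schur_proj K lam n t) = tmap \1%VF (schur_proj K mu n) (Phi t)) /\
    (forall (g : 'End(V)) s,
       Psi (schur_act e lam g s) = tmap g (schur_act e mu g) (Psi s)).
Proof.
pose F := (tmap \1%VF (schur_proj K mu n) \o Phi)%VF.
pose Psi := (F \o linfun (vsval : schur K lam n -> fmod K lam n))%VF; exists Psi.
have PsiE t : Psi (schur_proj K lam n t) = tmap \1%VF (schur_proj K mu n) (Phi t).
  rewrite /Psi /F !comp_lfunE [linfun _ _]lfunE /=; apply/eqP; rewrite -subr_eq0 -!linearB.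
  suff : vsval (schur_proj K lam n t) - t \in lker (schur_proj K lam n).
    by rewrite qproj_ker => /Phi_rels /= ->.
  by rewrite memv_ker linearB /= [X in X - _]qproj_vsval subrr.
split=> // g s; rewrite -(qproj_vsval s) -/(schur_proj K lam n) schur_actE !PsiE.
rewrite Phi_equivariant //; move: (Phi _) => u; rewrite (tens_decomp u) !linear_sum.
apply: eq_bigr => i _ /=; rewrite !tmap_tmul !id_lfunE.
by rewrite schur_actE.
Qed.

End Main.

Theorem theorem6p1
  (R : realType) (n : nat) (V : vectType R[i]) (e : n.-tuple V)
  (he : basis_of fullv e)
  (N : nat) (w h : nat -> nat)
  (hw0 : (0 < w 1)%N)
  (hw : forall b : nat, (1 <= b < N)%N -> (w b < w b.+1)%N)
  (hh : forall b : nat, (1 <= b <= N)%N -> (1 <= h b)%N)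
  (b1 : nat) (hb1 : (1 <= b1 <= N)%N) :
  let lam := diagram N w h in
  let mu := lam `\ box_x1 w b1 in
  let Phi := Phi1 e N w h b1 in
  [/\ (Phi @: rels R[i] lam n <= tensv fullv (rels R[i] mu n))%VS,
      (forall g : 'End(V), lker g = 0%VS ->
         forall t : fmod R[i] lam n,
         Phi (fact e lam g t) = tmap g (fact e mu g) (Phi t))
    & exists Psi : 'Hom(schur R[i] lam n, tens V (schur R[i] mu n)),
        (forall t : fmod R[i] lam n,
           Psi (schur_proj R[i] lam n t)
             = tmap \1%VF (schur_proj R[i] mu n) (Phi t)) /\
        (forall g : 'End(V), lker g = 0%VS ->
           forall s : schur R[i] lam n,
           Psi (schur_act e lam g s) = tmap g (schur_act e mu g) (Psi s))].
Proof.
move=> lam mu Phi; have char0 : [pchar R[i]] =i pred0 by exact: pchar_num.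
have Phi0 := Phi_rels e char0 hw0 hw hh hb1.
have PhiG := Phi_equivariant hw0 hw hh hb1 he.
split.
- apply/subvP => _ /memv_imgP[t tR ->]; apply: tmap_proj_ker; exact: Phi0.
- by move=> g _ t; apply: PhiG.
have [Psi [PsiE PsiG]] := Phi_descends char0 hw0 hw hh hb1 he.
by exists Psi; split=> // g _ s; apply: PsiG.
Qed.
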